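(* There exists a set $E\subset\mathbb{R}^2$ such that $0<\mathcal{H}^1(E)<\infty$, $E$ is purely $1$-unrectifiable, and, for every $p$ with $1\leq p<2$, $$\int_0^1\widetilde{\beta}_{\mathcal{H}^1|_E,p}^1(x,r)^2\,\frac{dr}{r}<\infty\quad\text{for }\mathcal{H}^1\text{-a.e. }x\in E.$$
   Context: $\mathcal{H}^1$ denotes $1$-dimensional Hausdorff measure and $\mathcal{H}^1|_E$ its restriction to $E$. For a measure $\mu$ in $\mathbb{R}^2$, $1\leq p<\infty$, $x\in\mathbb{R}^2$ and $r>0$, with $B(x,r)$ the ball of center $x$ and radius $r$, define $$\widetilde{\beta}_{\mu,p}^1(x,r)=\inf_{L\subset\mathbb{R}^2\text{ a line}}\left(\int_{B(x,r)}\left(\frac{\operatorname{dist}(y,L)}{r}\right)^p\,\frac{d\mu(y)}{\mu(B(x,r))}\right)^{1/p},$$ where the infimum is over all (affine) lines (note that the normalization is by $\mu(B(x,r))$). A Radon measure $\mu$ in $\mathbb{R}^2$ is $1$-rectifiable if there are Lipschitz maps $f_i:\mathbb{R}\to\mathbb{R}^2$, $i=1,2,\ldots$, such that $\mu(\mathbb{R}^2\setminus\bigcup_i f_i(\mathbb{R}))=0$, and $\mu$ is absolutely continuous with respect to $\mathcal{H}^1$. A set $F\subset\mathbb{R}^2$ is $1$-rectifiable if the measure $\mathcal{H}^1|_F$ is $1$-rectifiable. A set $E$ is purely $1$-unrectifiable if every $1$-rectifiable subset $F\subset E$ satisfies $\mathcal{H}^1(F)=0$. *)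

(* Defs.v *)
From HB Require Import structures.
From mathcomp Require Import all_boot all_order all_algebra.
From mathcomp Require Import all_classical all_reals all_analysis.
From mathcomp Require Import lra.

Set Implicit Arguments.
Unset Strict Implicit.
Unset Printing Implicit Defensive.

Import Order.TTheory GRing.Theory Num.Theory.
Import numFieldNormedType.Exports.

Local Open Scope classical_set_scope.
Local Open Scope ring_scope.

(** The library norm of [R * R] is the maximum norm, so Euclidean distances are
    defined here. The topology and the Borel sigma-algebra of [R * R] are those
    of the library. *)
Definition eucl_dist (R : realType) (x y : R * R) : R :=
  Num.sqrt ((x.1 - y.1) ^+ 2 + (x.2 - y.2) ^+ 2).

Definition eucl_ball (R : realType) (x : R * R) (r : R) : set (R * R) :=
  [set y | eucl_dist x y <= r].

Definition dist_to_set (R : realType) (x : R * R) (A : set (R * R)) : R :=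
  inf [set eucl_dist x y | y in A].

Definition affine_line (R : realType) (L : set (R * R)) : Prop :=
  exists a v : R * R,
    v <> (0, 0) /\ L = [set (a.1 + t * v.1, a.2 + t * v.2) | t in [set: R]].

(** The added point [0] makes the diameter of the empty set [0]. *)
Definition eucl_diam (R : realType) (A : set (R * R)) : \bar R :=
  ereal_sup (0%E |` [set (eucl_dist x.1 x.2)%:E | x in A `*` A]).

Local Open Scope ereal_scope.

Definition hausdorff_content (R : realType) (delta : R) (X : set (R * R)) :
    \bar R :=
  ereal_inf [set \sum_(k <oo) eucl_diam (A k) | A in
    [set A : (set (R * R))^nat |
      (forall k, eucl_diam (A k) <= delta%:E) /\ X `<=` \bigcup_k A k]].

Definition hausdorff1 (R : realType) (X : set (R * R)) : \bar R :=
  ereal_sup [set hausdorff_content delta X | delta in [set d : R | (0 < d)%R]].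

(** No measurability is asked of [E]: a measure on Borel sets is obtained anyway,
    see below. *)
Definition hausdorff1_restr (R : realType) (E X : set (R * R)) : \bar R :=
  hausdorff1 (X `&` E).

Section eucl_theory.
Context (R : realType).
Implicit Types (x y : R * R) (A B E X Y : set (R * R)).

Lemma eucl_dist_ge0 x y : (0 <= eucl_dist x y)%R.
Proof. exact: sqrtr_ge0. Qed.

Lemma ler_dist1 x y : (`|x.1 - y.1| <= eucl_dist x y)%R.
Proof. by rewrite -sqrtr_sqr ler_wsqrtr// lerDl sqr_ge0. Qed.

Lemma ler_dist2 x y : (`|x.2 - y.2| <= eucl_dist x y)%R.
Proof. by rewrite -sqrtr_sqr ler_wsqrtr// lerDr sqr_ge0. Qed.

Lemma eucl_diam_ge0 A : 0 <= eucl_diam A.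
Proof. by apply: ereal_sup_ubound; left. Qed.
Hint Resolve eucl_diam_ge0 : core.

Lemma eucl_diam0 : eucl_diam set0 = 0 :> \bar R.
Proof.
apply/eqP; rewrite eq_le eucl_diam_ge0 andbT.
by apply: ge_ereal_sup => _ [->//|[[? ?] [[]]]].
Qed.

Lemma le_eucl_diam A B : A `<=` B -> eucl_diam A <= eucl_diam B.
Proof.
move=> AB; apply: ge_ereal_sup => _ [->//|[[x y] [/= Ax Ay] <-]].
apply: ereal_sup_ubound; right; exists (x, y) => //=.
by split; apply: AB.
Qed.

Let gauge (d : R) (A : set (R * R)) : \bar R :=
  if eucl_diam A <= d%:E then eucl_diam A else +oo.

Let gauge_ge0 d A : 0 <= gauge d A.
Proof. by rewrite /gauge; case: ifP. Qed.

Let gauge0 d : (0 < d)%R -> gauge d set0 = 0.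
Proof. by move=> d0; rewrite /gauge eucl_diam0 lee_fin (ltW d0). Qed.

Let discreteT := g_sigma_algebraType [set: set (R * R)].

Let hausdorff_contentE d X :
  hausdorff_content d X = @mu_ext _ discreteT R (gauge d) X.
Proof.
apply/eqP; rewrite eq_le; apply/andP; split.
- apply: le_ereal_inf_tmp => _ [A [_ XA] <-].
  have [dA|] := pselect (forall k, eucl_diam (A k) <= d%:E).
    apply: ereal_inf_lbound; exists A => //.
    by apply: eq_eseriesr => k _; rewrite /gauge dA.
  move=> /existsNP[k /negP/negbTE dk].
  by rewrite (@eseries_pinfty _ _ _ k) ?leey// => [n _|];
    [rewrite -ltNye (lt_le_trans _ (gauge_ge0 _ _))|rewrite /gauge dk].
- apply: le_ereal_inf_tmp => _ [A [dA XA] <-].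
  apply: ereal_inf_lbound; exists A.
    by split=> // k; exact: sub_gen_smallest.
  by apply: eq_eseriesr => k _; rewrite /gauge dA.
Qed.

Lemma hausdorff_content_ge0 d X : 0 <= hausdorff_content d X.
Proof.
by apply: le_ereal_inf_tmp => _ [A _ <-]; exact: nneseries_ge0.
Qed.

Lemma hausdorff_content_le_hausdorff1 d X :
  (0 < d)%R -> hausdorff_content d X <= hausdorff1 X.
Proof. by move=> d0; apply: ereal_sup_ubound; exists d. Qed.

Lemma le_hausdorff_content d1 d2 X : (d1 <= d2)%R ->
  hausdorff_content d2 X <= hausdorff_content d1 X.
Proof.
move=> d12; apply: ereal_inf_le_tmp => _ [A [dA XA] <-].
by exists A => //; split => // k; rewrite (le_trans (dA k))// lee_fin.
Qed.

Lemma hausdorff1_ge0 X : 0 <= hausdorff1 X.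
Proof.
apply: le_trans (hausdorff_content_le_hausdorff1 X (ltr01 : 0 < 1)%R).
exact: hausdorff_content_ge0.
Qed.

Lemma hausdorff1_set0 : hausdorff1 set0 = 0 :> \bar R.
Proof.
apply/eqP; rewrite eq_le hausdorff1_ge0 andbT.
apply: ge_ereal_sup => _ [d /= d0 <-].
by rewrite hausdorff_contentE mu_ext0// gauge0.
Qed.

Lemma le_hausdorff1 :
  {homo (@hausdorff1 R) : A B / A `<=` B >-> A <= B}.
Proof.
move=> A B AB; apply: ge_ereal_sup => _ [d /= d0 <-].
apply: le_trans (hausdorff_content_le_hausdorff1 _ d0).
by rewrite !hausdorff_contentE; exact: le_mu_ext.
Qed.

Lemma hausdorff1_sigma_subadditive : sigma_subadditive (@hausdorff1 R).
Proof.
move=> F; apply: ge_ereal_sup => _ [d /= d0 <-].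
rewrite hausdorff_contentE.
have /le_trans := @mu_ext_sigma_subadditive _ discreteT R _ (gauge_ge0 d) F.
apply; apply: lee_nneseries => [i _ _|i _].
  by rewrite -hausdorff_contentE hausdorff_content_ge0.
by rewrite -hausdorff_contentE hausdorff_content_le_hausdorff1.
Qed.

End eucl_theory.

HB.instance Definition _ (R : realType) :=
  isOuterMeasure.Build R (R * R)%type (@hausdorff1 R) (@hausdorff1_set0 R)
    (@hausdorff1_ge0 R) (@le_hausdorff1 R) (@hausdorff1_sigma_subadditive R).

(** Borel sets are Caratheodory measurable for [hausdorff1], which is a metric
    outer measure. *)
Section hausdorff1_borel.
Context (R : realType).
Implicit Types (x y : R * R) (A B E X Y : set (R * R)).

Lemma hausdorff1_separated X Y (e : R) : (0 < e)%R ->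
  (forall x y, X x -> Y y -> e <= eucl_dist x y)%R ->
  hausdorff1 X + hausdorff1 Y <= hausdorff1 (X `|` Y).
Proof.
move=> e0 XY.
have [->|XYoo] := eqVneq (hausdorff1 (X `|` Y)) +oo; first exact: leey.
have sep d : (0 < d < e)%R ->
    hausdorff_content d X + hausdorff_content d Y <= hausdorff1 (X `|` Y).
  move=> /andP[d0 de]; apply: le_trans (hausdorff_content_le_hausdorff1 _ d0).
  apply: le_ereal_inf_tmp => _ [A [dA XYA] <-].
  have cov Z : Z `<=` X `|` Y ->
      hausdorff_content d Z <= \sum_(k <oo) eucl_diam (A k `&` Z).
    move=> ZXY; apply: ereal_inf_lbound; exists (fun k => A k `&` Z) => //.
    split=> [k|z Zz].
      by apply: le_trans (dA k); apply: le_eucl_diam => ? [].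
    by have [k _ Akz] := XYA _ (ZXY _ Zz); exists k.
  apply: le_trans (leeD (cov X _) (cov Y _)) _ => [? ?|? ?|]; [by left|by right|].
  rewrite -nneseriesD; [|by move=> *; exact: eucl_diam_ge0..].
  apply: lee_nneseries => [k _ _|k _].
    by apply: adde_ge0; exact: eucl_diam_ge0.
  have [[x [Ax Xx]]|] := pselect (exists x, (A k `&` X) x).
    suff -> : A k `&` Y = set0.
      by rewrite eucl_diam0 adde0; apply: le_eucl_diam => ? [].
    apply/seteqP; split=> // y [Ay Yy].
    have : (eucl_dist x y)%:E <= d%:E.
      apply: le_trans (dA k); apply: ereal_sup_ubound; right.
      by exists (x, y).
    by rewrite lee_fin leNgt (lt_le_trans de (XY _ _ Xx Yy)).
  move=> nX; have -> : A k `&` X = set0.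
    by apply/seteqP; split=> // x ?; apply: nX; exists x.
  by rewrite eucl_diam0 add0e; apply: le_eucl_diam => ? [].
have Yfin : hausdorff1 Y \is a fin_num.
  rewrite ge0_fin_numE ?hausdorff1_ge0// (@le_lt_trans _ _ (hausdorff1 (X `|` Y)))//.
    by apply: le_hausdorff1; right.
  by rewrite ltey.
rewrite -leeBrDr//; apply: ge_ereal_sup => _ [d1 /= d10 <-].
have cfin : hausdorff_content d1 X \is a fin_num.
  rewrite ge0_fin_numE ?hausdorff_content_ge0//.
  rewrite (@le_lt_trans _ _ (hausdorff1 (X `|` Y)))//; last by rewrite ltey.
  apply: le_trans (hausdorff_content_le_hausdorff1 _ d10) _.
  by apply: le_hausdorff1; left.
rewrite leeBrDr// addeC -leeBrDr//; apply: ge_ereal_sup => _ [d2 /= d20 <-].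
rewrite leeBrDr// addeC.
pose d := Num.min (Num.min d1 d2) (e / 2)%R.
have d0 : (0 < d < e)%R.
  by rewrite !lt_min d10 d20 divr_gt0//= !gt_min; apply/orP; right; lra.
apply: le_trans (sep d d0).
by apply: leeD; apply: le_hausdorff_content; rewrite !ge_min lexx ?orbT.
Qed.

Section lipschitz_ray.
Variables (f : R * R -> R).
Hypothesis fL : forall x y, (`|f x - f y| <= eucl_dist x y)%R.

Lemma caratheodory_hausdorff1_ray (a : R) :
  (@hausdorff1 R).-caratheodory (f @^-1` `]a, +oo[).
Proof.
apply: le_caratheodory_measurable => X; rewrite /=.
have [->|Xoo] := eqVneq (hausdorff1 X) +oo; first exact: leey.
have Hfin Z : Z `<=` X -> hausdorff1 Z \is a fin_num.
  move=> ZX; rewrite ge0_fin_numE ?hausdorff1_ge0//.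
  by rewrite (le_lt_trans (le_hausdorff1 ZX))// ltey.
pose u (k : nat) : R := (k.+1%:R^-1)%R.
have u0 k : (0 < u k)%R by rewrite invr_gt0.
have uS k : (u k.+1 < u k)%R by rewrite /u ltf_pV2 ?posrE ?ltr_nat.
pose A k := X `&` [set x | a + u k < f x]%R.
pose D k := A k.+1 `\` A k.
have AX k : A k `<=` X by move=> ? [].
have DX k : D k `<=` X by move=> ? [] [].
have sepL Y Z (c d : R) : (d < c)%R -> (forall y, Y y -> c <= f y)%R ->
    (forall z, Z z -> f z <= d)%R ->
    hausdorff1 Y + hausdorff1 Z <= hausdorff1 (Y `|` Z).
  move=> dc Yc Zd; apply: (@hausdorff1_separated _ _ (c - d)%R).
    by rewrite subr_gt0.
  move=> y z /Yc cy /Zd zd; apply: le_trans (fL y z).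
  by apply: le_trans (ler_norm _); lra.
have AC k : hausdorff1 (A k) + hausdorff1 (X `&` ~` (f @^-1` `]a, +oo[)) <=
    hausdorff1 X.
  apply: (@le_trans _ _ (hausdorff1 (A k `|` X `&` ~` (f @^-1` `]a, +oo[)))).
    refine (@sepL _ _ (a + u k)%R a _ _ _); first by rewrite ltrDl.
      by move=> y [_ /ltW].
    by move=> z [_]; rewrite /= in_itv/= andbT => /negP; rewrite -leNgt.
  by apply: le_hausdorff1 => x [/AX//|[]].
have step k : hausdorff1 (A k) + hausdorff1 (D k.+1) <= hausdorff1 (A k.+2).
  apply: (@le_trans _ _ (hausdorff1 (A k `|` D k.+1))).
    refine (@sepL _ _ (a + u k)%R (a + u k.+1)%R _ _ _); first by rewrite ltrD2l.
      by move=> y [_ /ltW].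
    move=> z [[Xz _]] nA; rewrite leNgt; apply/negP => az; exact: nA.
  apply: le_hausdorff1 => x [[Xx /= ax]|[]//]; split => //=.
  by have := uS k; have := uS k.+1; lra.
have sumD n : \sum_(k < n) hausdorff1 (D k.+1) <= hausdorff1 X + hausdorff1 X.
  apply: (@le_trans _ _ (hausdorff1 (A n) + hausdorff1 (A n.+1))); last first.
    by apply: leeD; exact: le_hausdorff1.
  elim: n => [|n ih]; first by rewrite big_ord0 adde_ge0// hausdorff1_ge0.
  rewrite big_ord_recr/=; apply: le_trans (leeD ih (lexx _)) _.
  by rewrite addeAC addeC; apply: leeD => //; exact: step.
have serD : \sum_(k <oo) hausdorff1 (D k) < +oo.
  apply: (@le_lt_trans _ _ (hausdorff1 X + (hausdorff1 X + hausdorff1 X))).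
    apply: lime_le; first by apply: is_cvg_nneseries => *; exact: hausdorff1_ge0.
    apply: nearW => -[|n]; first by rewrite big_mkord big_ord0 !adde_ge0// hausdorff1_ge0.
    by rewrite big_mkord big_ord_recl leeD// le_hausdorff1.
  by rewrite !lte_add_pinfty// ltey.
have tail n : hausdorff1 (X `&` f @^-1` `]a, +oo[) <=
    hausdorff1 (A n) + \sum_(n <= k <oo) hausdorff1 (D k).
  apply: (@le_trans _ _ (hausdorff1 (A n `|` \bigcup_(k in ~` `I_n) D k))).
    apply: le_hausdorff1 => x [Xx]; rewrite /= in_itv/= andbT => ax.
    have exN : exists N, (a + u N < f x)%R.
      have fxa : (0 < f x - a)%R by rewrite subr_gt0.
      have [N _ /(_ N (leqnn N))] := near_infty_natSinv_lt (PosNum fxa).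
      by rewrite /= => uN; exists N; rewrite -ltrBrDl.
    have [AN|nAN] := pselect (A n x); [by left|right].
    case: (ex_minnP exN) => -[|N] aN minN.
      exfalso; apply: nAN; split=> //=.
      suff : (u n <= u 0%N)%R by move: aN; lra.
      by rewrite /u lef_pV2 ?posrE// ler_nat.
    exists N; last first.
      split; first by split.
      by move=> [_ /= /minN]; rewrite ltnn.
    rewrite /= => Nn; apply: nAN; split=> //=.
    suff : (u n <= u N.+1)%R by move: aN; lra.
    by rewrite /u lef_pV2 ?posrE// ler_nat.
  apply: le_trans (outer_measureU2 _ _ _) _; apply: leeD => //.
  exact: outer_measure_sigma_subadditive_tail.
have cvgT : \sum_(n <= k <oo) hausdorff1 (D k) @[n --> \oo] --> (0 : \bar R).
  by apply: nneseries_tail_cvg => // k _; exact: hausdorff1_ge0.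
have cvgX : hausdorff1 X + \sum_(n <= k <oo) hausdorff1 (D k) @[n --> \oo]
    --> hausdorff1 X.
  rewrite -[X in _ --> X]adde0; apply: cvgeD => //; last exact: cvg_cst.
  by rewrite fin_num_adde_defl// Hfin.
rewrite -(cvg_lim _ cvgX)//; apply: lime_ge; first by apply/cvg_ex; exists (hausdorff1 X).
apply: nearW => n; apply: le_trans (leeD (tail n) (lexx _)) _.
by rewrite addeAC leeD.
Qed.

End lipschitz_ray.

Lemma caratheodory_hausdorff1_preimage (f : R * R -> R) :
  (forall x y, (`|f x - f y| <= eucl_dist x y)%R) ->
  measurable_fun setT (f : caratheodory_type (@hausdorff1 R) -> R).
Proof.
move=> fL; apply: (measurability _ (measurable_realfun.RGenOInfty.measurableE R)) => _ [_ [a ->] <-].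
by rewrite setTI; exact: caratheodory_hausdorff1_ray.
Qed.

Lemma caratheodory_hausdorff1_borel A :
  measurable A -> (@hausdorff1 R).-caratheodory A.
Proof.
move=> mA.
have : measurable_fun setT
    (fun x : caratheodory_type (@hausdorff1 R) => (x.1, x.2) : R * R).
  apply/measurable_fun_pair.
    exact/caratheodory_hausdorff1_preimage/ler_dist1.
  exact/caratheodory_hausdorff1_preimage/ler_dist2.
move=> /(_ measurableT A mA); rewrite setTI.
by rewrite (_ : _ @^-1` A = A)//; apply/seteqP; split=> -[].
Qed.

Lemma hausdorff1_restr_sigma_additive E :
  semi_sigma_additive (hausdorff1_restr E : set (R * R)%type -> \bar R).
Proof.
move=> F mF tF mUF.
have cF k := caratheodory_hausdorff1_borel (mF k).
suff <- : \sum_(k <oo) hausdorff1_restr E (F k) =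
    hausdorff1_restr E (\bigcup_k F k).
  by apply: is_cvg_nneseries => *; exact: hausdorff1_ge0.
rewrite /hausdorff1_restr; under eq_eseriesr do rewrite setIC.
rewrite setIC; apply/eqP; rewrite eq_le outer_measure_bigcup_lim andbT.
set X := E `&` \bigcup_k F k.
apply: le_trans (caratheodory_lime_le cF tF X).
rewrite (_ : X `&` ~` _ = set0); last by rewrite /X -setIA setICr setI0.
rewrite outer_measure0 adde0; apply: lee_nneseries => [*|k _].
  exact: hausdorff1_ge0.
apply: le_hausdorff1 => x [Ex Fx]; split=> //.
by split=> //; exists k.
Qed.

Lemma hausdorff1_sigma_additive : semi_sigma_additive (@hausdorff1 R : set (R * R)%type -> \bar R).
Proof.
have <- : hausdorff1_restr setT = @hausdorff1 R.
  by apply/funext => A; rewrite /hausdorff1_restr setIT.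
exact: hausdorff1_restr_sigma_additive.
Qed.

Lemma hausdorff1_restr0 E : hausdorff1_restr E set0 = 0 :> \bar R.
Proof. by rewrite /hausdorff1_restr set0I hausdorff1_set0. Qed.

Lemma hausdorff1_restr_ge0 E A : 0 <= hausdorff1_restr E A.
Proof. exact: hausdorff1_ge0. Qed.

End hausdorff1_borel.

HB.instance Definition _ (R : realType) :=
  isMeasure.Build _ (R * R)%type R (@hausdorff1 R) (@hausdorff1_set0 R)
    (@hausdorff1_ge0 R) (@hausdorff1_sigma_additive R).

HB.instance Definition _ (R : realType) (E : set (R * R)) :=
  isMeasure.Build _ (R * R)%type R (hausdorff1_restr E) (hausdorff1_restr0 E)
    (hausdorff1_restr_ge0 E) (@hausdorff1_restr_sigma_additive R E).

(** Balls are closed. On a [mu]-null ball the value is [0], as [0 * +oo = 0] in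
    the library. *)
Definition beta_tilde (R : realType)
    (mu : {measure set (R * R)%type -> \bar R}) (p : R) (x : R * R) (r : R) :
    \bar R :=
  ereal_inf [set
    ((\int[mu]_(y in eucl_ball x r) ((dist_to_set y L / r) `^ p)%:E)
       / mu (eucl_ball x r)) `^ p^-1
    | L in @affine_line R].

Definition radon (R : realType) (mu : {measure set (R * R)%type -> \bar R}) :
    Prop :=
  [/\ (forall K : set (R * R), compact K -> mu K < +oo),
      (forall V : set (R * R), open V ->
         mu V = ereal_sup [set mu K | K in [set K | compact K /\ K `<=` V]]) &
      (forall A : set (R * R), measurable A ->
         mu A = ereal_inf [set mu V | V in [set V | open V /\ A `<=` V]])].

Definition lipschitz_curve (R : realType) (f : R -> R * R) : Prop :=
  exists C : R, forall s t : R, (eucl_dist (f s) (f t) <= C * `|s - t|)%R.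

Definition rectifiable_measure (R : realType)
    (mu : {measure set (R * R)%type -> \bar R}) : Prop :=
  [/\ radon mu,
      (exists f : nat -> R -> R * R, (forall i, lipschitz_curve (f i)) /\
         mu (~` \bigcup_i range (f i)) = 0) &
      mu `<< @hausdorff1 R].

Definition rectifiable_set (R : realType) (F : set (R * R)) : Prop :=
  rectifiable_measure (hausdorff1_restr F).

Definition purely_unrectifiable (R : realType) (E : set (R * R)) : Prop :=
  forall F : set (R * R), F `<=` E -> rectifiable_set F -> hausdorff1 F = 0.

(* Main.v *)
Require Import Defs.
From HB Require Import structures.
From mathcomp Require Import all_boot all_order all_algebra.
From mathcomp Require Import all_classical all_reals all_analysis.
From mathcomp Require Import measurable_realfun lra ring zify.

(** The set is the graph of a discontinuous function [height] on [[0, 1)]. At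
    stage [k] every interval of generation [k] (a cell, of length [len k]) is cut
    into [branching k] children of equal length, and the part of the graph above
    the first child is lifted by [hgt k = len k / 16]. The proportion
    [eps k = (branching k)^-1] of the mass that moves at stage [k] is of the
    order of [1 / k], and this meets two competing demands.

    Since [eps] is not summable, almost every point is lifted infinitely often
    ([finitely_lifted_null]). A piece lifted at stage [k] has a diameter
    comparable with [eps k * len k], but its distance to the rest of the graph is
    comparable with [len k] ([lifted_isolated]). When a Lipschitz map [f] visits
    such a piece, the preimage of the graph under [f] therefore has a gap of
    length comparable with [len k] immediately after the last visit. Portions of
    these gaps are pairwise disjoint over all the stages, so that the sum of the
    lengths of the gaps is finite on a bounded segment, and with it the sum of
    the masses of all the lifted pieces that [f] visits. By the Borel-Cantelli
    lemma almost no point in the range of [f] is lifted infinitely often, so that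
    the graph meets the range in a null set ([lipschitz_image_null]).

    On the other hand [eps `^ (2 / p)] is summable because [p < 2]. A ball of
    radius [r] between about [hgt k.+1] and about [hgt k], centred on the graph,
    sees a horizontal line, except for a proportion of its mass that is at most
    a multiple of [eps k.+1] and lies [hgt k.+1] higher. Testing the coefficient with this
    line gives [beta ^+ 2 <= C * eps k.+1 `^ (2 / p) * (len k.+1 / r)], and the
    integral of this bound against [dr / r] over the range is at most a multiple
    of [eps k.+1 `^ (2 / p)] ([beta2_far], [beta2_near_grounded]). The bound fails
    if the centre itself is lifted at stage [k.+1] and [r] is close to [hgt k.+1]:
    the ball then just touches the line below, and may contain less mass there
    than in the small piece around its centre. Let [s] be the square root of
    [eps k.+1]. The radii of the range below [hgt k.+1 * (1 + s)] have a logarithmic measure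
    comparable with [s], and for the larger ones the ball contains enough of the
    line to give [beta ^+ 2 <= C * s] ([beta2_near_lifted]). This costs
    a multiple of [s] at the centres that are lifted at stage [k.+1], whose mass is
    at most a multiple of [eps k.+1]; as [eps `^ (3 / 2)] is summable, the total
    cost is finite at almost every point ([lift_sum_ae]). *)

Set Implicit Arguments.
Unset Strict Implicit.
Unset Printing Implicit Defensive.

Import Order.TTheory GRing.Theory Num.Theory.
Import numFieldNormedType.Exports.

Local Open Scope classical_set_scope.
Local Open Scope ring_scope.

(** * The graph *)

(** The growth is linear, so that [eps] is not summable while [eps `^ s] is for
    [1 < s]; the summand [64 ^ 2] makes [Num.sqrt (eps k)] at most [64^-1]. *)
HB.lock Definition branching (k : nat) : nat := (k + 64 ^ 2)%N.

Definition ncells k : nat := (\prod_(j < k) branching j)%N.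

Lemma branching_gt0 k : (0 < branching k)%N.
Proof. by rewrite branching.unlock addn_gt0 orbC expn_gt0. Qed.

Lemma ncells_gt0 k : (0 < ncells k)%N.
Proof. by apply: prodn_gt0 => i; exact: branching_gt0. Qed.

Lemma ncellsS k : ncells k.+1 = (ncells k * branching k)%N.
Proof. by rewrite /ncells big_ord_recr. Qed.

Section graph.
Context {R : realType}.
Implicit Types (x y r : R) (k j : nat).

Definition len k : R := (ncells k)%:R^-1.
Definition eps k : R := (branching k)%:R^-1.
Definition hgt k : R := len k / 16.
Definition cell k x : nat := Num.truncn (x * (ncells k)%:R).
(** In the cell of [x] of generation [k], [x] lies in the first child. *)
Definition lifted k x : bool := x * (ncells k)%:R - (cell k x)%:R < eps k.
(** The height of the graph above [x] after the stages [j < k]. *)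
Definition base k x : R := \sum_(j < k) hgt j *+ lifted j x.
Definition height x : R := limn (base ^~ x).

Lemma ncellsR_gt0 k : 0 < (ncells k)%:R :> R.
Proof. by rewrite ltr0n ncells_gt0. Qed.

Lemma len_gt0 k : 0 < len k.
Proof. by rewrite invr_gt0 ncellsR_gt0. Qed.

Lemma eps_gt0 k : 0 < eps k.
Proof. by rewrite invr_gt0 ltr0n branching_gt0. Qed.

Lemma hgt_gt0 k : 0 < hgt k.
Proof. by rewrite divr_gt0// len_gt0. Qed.

Lemma lenS k : len k.+1 = eps k * len k.
Proof. by rewrite /len ncellsS natrM invfM mulrC. Qed.

Lemma hgtS k : hgt k.+1 = eps k * hgt k.
Proof. by rewrite /hgt lenS mulrA. Qed.

Lemma len0 : len 0 = 1.
Proof. by rewrite /len /ncells big_ord0 invr1. Qed.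

Lemma len_ncells k : len k * (ncells k)%:R = 1.
Proof. by rewrite mulVf// gt_eqF// ncellsR_gt0. Qed.

Lemma sqrt_eps_le k : Num.sqrt (eps k) <= 64^-1.
Proof.
have -> : 64^-1 = Num.sqrt (64^-1 ^+ 2) :> R by rewrite sqrtr_sqr ger0_norm.
rewrite ler_wsqrtr// exprVn lef_pV2 ?posrE ?exprn_gt0 ?ltr0n ?branching_gt0//.
by rewrite -natrX ler_nat branching.unlock leq_addl.
Qed.

Lemma sqrt_eps_gt0 k : 0 < Num.sqrt (eps k).
Proof. by rewrite sqrtr_gt0 eps_gt0. Qed.

Lemma sqr_sqrt_eps k : Num.sqrt (eps k) * Num.sqrt (eps k) = eps k.
Proof. by rewrite -expr2 sqr_sqrtr// ltW// eps_gt0. Qed.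

Lemma eps_le_sqrt k : eps k <= Num.sqrt (eps k) / 64.
Proof. by rewrite -{1}sqr_sqrt_eps ler_wpM2l ?sqrt_eps_le// ltW// sqrt_eps_gt0. Qed.

Lemma eps_le k : eps k <= 64^-1.
Proof. have := eps_le_sqrt k; have := sqrt_eps_le k; lra. Qed.

Lemma lenS_le k : len k.+1 <= len k / 64.
Proof. by rewrite lenS mulrC ler_wpM2l ?eps_le// ltW// len_gt0. Qed.

Lemma le_len j k : (j <= k)%N -> len k <= len j.
Proof.
move=> /subnK <-; elim: (k - j)%N => // n; rewrite addSn.
have := lenS_le (n + j); have := len_gt0 (n + j); lra.
Qed.

Lemma baseS k x : base k.+1 x = base k x + hgt k *+ lifted k x.
Proof. by rewrite /base big_ord_recr. Qed.

Lemma base_le k j x : (k <= j)%N -> base k x <= base j x.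
Proof.
move=> /subnK <-; elim: (j - k)%N => // n ih; rewrite addSn baseS.
by rewrite (le_trans ih)// lerDl mulrn_wge0// ltW// hgt_gt0.
Qed.

(** All the later liftings together amount to at most [2 * hgt k], as [hgt]
    decreases geometrically. *)
Lemma base_top_ge k j x : (k <= j)%N -> base j x + 2 * hgt j <= base k x + 2 * hgt k.
Proof.
move=> /subnK <-; elim: (j - k)%N => // n; rewrite addSn baseS hgtS.
have := eps_le (n + k); have h0 := hgt_gt0 (n + k); move: (eps _) => e e1 ih.
suff : hgt (n + k) *+ lifted (n + k) x + 2 * (e * hgt (n + k)) <= 2 * hgt (n + k) by lra.
have : e * hgt (n + k) <= 64^-1 * hgt (n + k) by rewrite ler_wpM2r// ltW.
by case: lifted; rewrite ?mulr1n ?mulr0n; lra.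
Qed.

Lemma base_le_top k j x : base j x <= base k x + 2 * hgt k.
Proof.
have [kj|jk] := leqP k j.
  by apply: le_trans (base_top_ge x kj); rewrite lerDl mulr_ge0// ltW// hgt_gt0.
apply: le_trans (base_le x (ltnW jk)) _.
by rewrite lerDl mulr_ge0// ltW// hgt_gt0.
Qed.

Lemma cvg_base x : base ^~ x @ \oo --> height x.
Proof.
apply: nondecreasing_is_cvgn; first by move=> k j; exact: base_le.
by exists (base 0 x + 2 * hgt 0) => _ [j _ <-]; exact: base_le_top.
Qed.

Lemma base_le_height k x : base k x <= height x.
Proof.
apply: limr_ge; first exact: cvg_base.
by near=> n; apply: base_le; near: n; exact: nbhs_infty_ge.
Unshelve. all: by end_near. Qed.

Lemma height_le_base k x : height x <= base k x + 2 * hgt k.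
Proof.
apply: limr_le; first exact: cvg_base.
by near=> n; exact: base_le_top.
Unshelve. all: by end_near. Qed.

Lemma le_hgt_sep j k : (j <= k)%N -> hgt k * (1 - 2 * eps k) <= hgt j * (1 - 2 * eps j).
Proof.
move=> /subnK <-; elim: (k - j)%N => // n ih; rewrite addSn.
apply: le_trans ih; rewrite hgtS.
have := hgt_gt0 (n + j); have := eps_le (n + j); have := eps_le (n + j).+1.
have := eps_gt0 (n + j); have := eps_gt0 (n + j).+1.
move: (eps _) (eps _) (hgt _) => a b c a0 b0 aM bM c0.
have : b * c <= 64^-1 * c by rewrite ler_wpM2r// ltW.
have : 0 <= b * c * a by rewrite !mulr_ge0// ltW.
nra.
Qed.

(** Heights are ordered lexicographically: at the first stage [j] at which [x]
    and [y] are treated differently, the difference [hgt j] exceeds whatever the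
    later stages can compensate, which is at most [2 * hgt j.+1]. *)
Lemma height_sep k x y : `|height x - height y| < hgt k * (1 - 2 * eps k) ->
  forall j, (j <= k)%N -> lifted j x = lifted j y.
Proof.
move=> xy j jk; have {xy} : `|height x - height y| < hgt j * (1 - 2 * eps j).
  exact: lt_le_trans (le_hgt_sep jk).
elim/ltn_ind: j jk => j ih jk xy.
have jbase : base j x = base j y.
  rewrite /base; apply: eq_bigr => i _; rewrite (ih i)//.
    exact: leq_trans (ltnW (ltn_ord i)) jk.
  exact: lt_le_trans xy (le_hgt_sep (ltnW (ltn_ord i))).
move: xy (base_le_height j.+1 x) (height_le_base j.+1 x).
move: (base_le_height j.+1 y) (height_le_base j.+1 y).
rewrite !baseS jbase hgtS ltr_norml.
by case: (lifted j x) (lifted j y) => [] [] //; rewrite ?mulr1n ?mulr0n; lra.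
Qed.

Lemma height_sep_base k x y : `|height x - height y| < hgt k * (1 - 2 * eps k) ->
  forall j, (j <= k.+1)%N -> base j x = base j y.
Proof.
move=> xy j jk; apply: eq_bigr => i _; rewrite (height_sep xy)//.
by rewrite -ltnS (leq_trans (ltn_ord i)).
Qed.

Lemma cell_itv k x : 0 <= x ->
  (cell k x)%:R * len k <= x < (cell k x).+1%:R * len k.
Proof.
move=> x0; rewrite ler_pdivrMr ?ltr_pdivlMr ?ncellsR_gt0//.
by rewrite truncn_itv// mulr_ge0.
Qed.

Lemma cell_unique k x i : i%:R * len k <= x < i.+1%:R * len k -> cell k x = i.
Proof.
rewrite ler_pdivrMr ?ltr_pdivlMr ?ncellsR_gt0// => xi.
exact: truncn_def.
Qed.

Lemma cell_lt k x : 0 <= x < 1 -> (cell k x < ncells k)%N.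
Proof.
move=> /andP[x0 x1]; have /andP[h _] := cell_itv k x0.
rewrite -(@ltr_nat R) -[ltRHS]mul1r -ltr_pdivrMr ?ncellsR_gt0//.
exact: le_lt_trans h x1.
Qed.

Lemma cellS k x : 0 <= x -> cell k x = (cell k.+1 x %/ branching k)%N.
Proof.
move=> x0; apply: cell_unique; have := cell_itv k.+1 x0.
have n0 : 0 < (branching k)%:R :> R by rewrite ltr0n branching_gt0.
move: (cell k.+1 x) => c; rewrite lenS !mulrA => /andP[ca cb].
apply/andP; split.
  apply: le_trans ca; rewrite ler_wpM2r ?(ltW (len_gt0 _))//.
  by rewrite ler_pdivlMr// -natrM ler_nat leq_divM.
apply: lt_le_trans cb _; rewrite ler_wpM2r ?(ltW (len_gt0 _))//.
by rewrite ler_pdivrMr// -natrM ler_nat ltn_ceil// branching_gt0.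
Qed.

Lemma lifted_itv k x : lifted k x = (x < (cell k x)%:R * len k + len k.+1).
Proof.
rewrite /lifted -(ltr_pM2r (len_gt0 k)) mulrBl -mulrA.
by rewrite [(ncells k)%:R * _]mulrC len_ncells mulr1 -lenS ltrBlDl.
Qed.

Lemma liftedE k x : 0 <= x -> lifted k x = (branching k %| cell k.+1 x)%N.
Proof.
move=> x0; rewrite lifted_itv cellS//; have := cell_itv k.+1 x0.
set n := branching k; set c := cell k.+1 x.
have -> : (c %/ n)%:R * len k + len k.+1 = (c %/ n * n).+1%:R * len k.+1.
  rewrite lenS -natr1 natrM mulrDl mul1r -mulrA [n%:R * _]mulrA divff ?mul1r//.
  by rewrite pnatr_eq0 -lt0n branching_gt0.
rewrite dvdn_eq => /andP[ca cb].
have le := leq_divM c n.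
apply/idP/idP => [xc|/eqP -> //]; rewrite eqn_leq le/=.
have := le_lt_trans ca xc.
by rewrite ltr_pM2r ?len_gt0// ltr_nat ltnS.
Qed.

Lemma cell_eq_le j k x y : 0 <= x -> 0 <= y -> (j <= k)%N ->
  cell k x = cell k y -> cell j x = cell j y.
Proof.
move=> x0 y0 /subnK <-; elim: (k - j)%N => // n ih; rewrite addSn => xy.
by apply: ih; rewrite (cellS _ x0) (cellS _ y0) xy.
Qed.

Lemma cell_eq_lifted j k x y : 0 <= x -> 0 <= y -> (j < k)%N ->
  cell k x = cell k y -> lifted j x = lifted j y.
Proof.
by move=> x0 y0 jk xy; rewrite !liftedE// (cell_eq_le x0 y0 jk xy).
Qed.

Lemma cell_eq_base k x y : 0 <= x -> 0 <= y ->
  cell k x = cell k y -> base k x = base k y.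
Proof.
move=> x0 y0 xy; apply: eq_bigr => i _.
by rewrite (cell_eq_lifted x0 y0 (ltn_ord i) xy).
Qed.

(** Closeness of the heights makes [y] lifted as well, and the first children of
    distinct cells are further apart than [hgt k]. *)
Lemma lifted_isolated k x y : 0 <= x -> 0 <= y -> lifted k x ->
  `|x - y| < hgt k -> `|height x - height y| < hgt k * (1 - 2 * eps k) ->
  cell k.+1 x = cell k.+1 y.
Proof.
move=> x0 y0 lx xy hxy; have ly : lifted k y by rewrite -(height_sep hxy).
have cxy : cell k x = cell k y.
  move: lx ly; rewrite !lifted_itv.
  have /andP[+ _] := cell_itv k x0; have /andP[+ _] := cell_itv k y0.
  have := lenS_le k; have := len_gt0 k; move: xy; rewrite /hgt ltr_norml.
  move: (cell k x) (cell k y) => a b /andP[d1 d2] l0 l1 h1 h2 h3 h4.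
  apply/eqP; rewrite eqn_leq; apply/andP; split; rewrite -ltnS -(@ltr_nat R).
    rewrite -(ltr_pM2r l0); move: h1 h2 h3 h4; rewrite -natr1 mulrDl mul1r; lra.
  rewrite -(ltr_pM2r l0); move: h1 h2 h3 h4; rewrite -natr1 mulrDl mul1r; lra.
move: lx ly; rewrite !liftedE// => /divnK <- /divnK <-.
by rewrite -!cellS// cxy.
Qed.

End graph.

(** * Hausdorff measure of parts of the graph *)

Section hausdorff_estimates.
Context {R : realType}.
Implicit Types (A X : set (R * R)).

Lemma eucl_dist_le (x y : R * R) (a b : R) :
  `|x.1 - y.1| <= a -> `|x.2 - y.2| <= b -> eucl_dist x y <= a + b.
Proof.
move=> ha hb; have a0 : 0 <= a := le_trans (normr_ge0 _) ha.
have b0 : 0 <= b := le_trans (normr_ge0 _) hb.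
have -> : a + b = Num.sqrt ((a + b) ^+ 2) by rewrite sqrtr_sqr ger0_norm// addr_ge0.
have sq (u v : R) : 0 <= v -> `|u| <= v -> u ^+ 2 <= v ^+ 2.
  by move=> v0 uv; rewrite -real_normK ?num_real// ler_sqr ?nnegrE.
rewrite ler_wsqrtr//; have := sq _ _ a0 ha; have := sq _ _ b0 hb.
have : 0 <= a * b by rewrite mulr_ge0.
by rewrite sqrrD; lra.
Qed.

Lemma eucl_diam_le A (d : R) : 0 <= d ->
  (forall x y, A x -> A y -> eucl_dist x y <= d) -> (eucl_diam A <= d%:E)%E.
Proof.
move=> d0 Ad; apply: ge_ereal_sup => _ [->|[[x y] [/= Ax Ay] <-]].
  by rewrite lee_fin.
by rewrite lee_fin Ad.
Qed.

Lemma hausdorff_content_le_size (T : eqType) (s : seq T) (A : T -> set (R * R))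
    X (d delta : R) : 0 <= d <= delta ->
  (forall i, (eucl_diam (A i) <= d%:E)%E) ->
  (forall z, X z -> exists2 i, i \in s & A i z) ->
  (hausdorff_content delta X <= ((size s)%:R * d)%:E)%E.
Proof.
move=> /andP[d0 dd] dA XA.
pose B k := nth set0 [seq A i | i <- s] k.
have dB k : (eucl_diam (B k) <= d%:E)%E.
  have [ks|ks] := ltnP k (size s); last first.
    by rewrite /B nth_default ?size_map// eucl_diam0 lee_fin.
  have /mapP[i _ Bi] : B k \in [seq A i | i <- s] by rewrite mem_nth// size_map.
  by rewrite Bi.
apply: (@le_trans _ _ (\sum_(k <oo) eucl_diam (B k))%E).
  apply: ereal_inf_lbound; exists B => //; split=> [k|z /XA[i si Aiz]].
    by rewrite (le_trans (dB k))// lee_fin.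
  exists (index i s) => //; rewrite /B (nth_map i) ?index_mem//.
  by rewrite nth_index.
apply: lime_le; first by apply: is_cvg_nneseries => *; exact: eucl_diam_ge0.
apply: nearW => n; apply: (@le_trans _ _ (\sum_(0 <= k < minn n (size s)) d%:E)%E).
  have [ns|sn] := leqP n (size s).
    by apply: lee_sum => k _; exact: dB.
  rewrite (big_cat_nat (leq0n _) (ltnW sn))/= [X in (_ + X)%E]big1_seq ?adde0.
    by apply: lee_sum => k _; exact: dB.
  move=> k; rewrite mem_index_iota => /andP[_ /andP[sk _]].
  by rewrite /B nth_default ?size_map// eucl_diam0.
rewrite sumEFin lee_fin sumr_const_nat subn0 -[leLHS]mulr_natl ler_wpM2r//.
by rewrite ler_nat geq_minr.
Qed.

(** The projection to the first axis does not increase distances; enclosing the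
    projection of a set in an interval centred at one of its points costs the
    factor [2]. *)
Lemma hausdorff1_ge_projection X (a b : R) :
  (forall t, a <= t < b -> exists2 z, X z & z.1 = t) ->
  (((b - a) / 2)%:E <= hausdorff1 X)%E.
Proof.
move=> Xab; apply: le_trans (hausdorff_content_le_hausdorff1 X (ltr01 : 0 < 1)).
apply: le_ereal_inf_tmp => _ [A [dA XA] <-].
have [ab|ba] := ltP a b; last first.
  apply: (@le_trans _ _ 0%E); last by apply: nneseries_ge0 => *; exact: eucl_diam_ge0.
  by rewrite lee_fin; lra.
have dfin k : eucl_diam (A k) \is a fin_num.
  by rewrite ge0_fin_numE ?eucl_diam_ge0// (le_lt_trans (dA k))// ltry.
have /choice[F FA] : forall k, exists I : set R,
    [/\ measurable I, (lebesgue_measure I <= 2%:E * eucl_diam (A k))%E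
      & forall z, A k z -> I z.1].
  move=> k; have [[z Az]|nA] := pselect (exists z, A k z); last first.
    exists set0; split=> // [|z Az]; last by case: nA; exists z.
    by rewrite measure0 mule_ge0// eucl_diam_ge0.
  have d0 : 0 <= fine (eucl_diam (A k)) by rewrite fine_ge0// eucl_diam_ge0.
  exists `[z.1 - fine (eucl_diam (A k)), z.1 + fine (eucl_diam (A k))]%classic.
  split=> //.
    rewrite lebesgue_measure_itv/= lte_fin -(fineK (dfin k)).
    case: ifPn => _; last by rewrite -EFinM lee_fin mulr_ge0.
    by rewrite -EFinB -EFinM lee_fin /=; lra.
  move=> y Ay; rewrite /= in_itv/= -ler_distlC.
  apply: le_trans (ler_dist1 z y) _; rewrite -lee_fin fineK//.
  by apply: ereal_sup_ubound; right; exists (z, y).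
have : (lebesgue_measure `[a, b[ <= \sum_(k <oo) lebesgue_measure (F k))%E.
  apply: measure_sigma_subadditive => // [k|t]; first by have [] := FA k.
  rewrite /= in_itv/= => /Xab[z /XA[k _ Az] <-]; exists k => //.
  by have [_ _] := FA k; exact.
rewrite lebesgue_measure_itv/= lte_fin ab => h.
have : ((b - a)%:E <= \sum_(k <oo) 2%:E * eucl_diam (A k))%E.
  apply: le_trans h _; apply: lee_nneseries => [k _ _|k _]; last by have [] := FA k.
  exact: measure_ge0.
rewrite nneseriesZl//; last by move=> *; exact: eucl_diam_ge0.
move: (limn _) => S h2.
rewrite EFinM muleC -[S]mul1e -(_ : 2^-1%:E * 2%:E = 1)%E.
  by rewrite -muleA lee_wpmul2l.
by rewrite -EFinM mulVf.
Qed.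

End hausdorff_estimates.

Section graph_measure.
Context {R : realType}.
Implicit Types (x y a w : R) (k M : nat).

Definition jump_graph : set (R * R) := [set z | 0 <= z.1 < 1 /\ z.2 = height z.1].

Definition lifts k : set R := [set x | lifted k x].

Notation mu := (hausdorff1_restr jump_graph).

Lemma len_lt (e : R) : 0 < e -> exists k, forall j, (k <= j)%N -> len j < e.
Proof.
move=> e0; have [k _ /(_ k (leqnn k))/= ke] := near_infty_natSinv_lt (PosNum e0).
exists k => j kj; apply: le_lt_trans (le_len kj) _; apply: le_lt_trans ke.
rewrite /len lef_pV2 ?posrE ?ncellsR_gt0// ler_nat.
elim: k {kj} => [|k ih]; first exact: ncells_gt0.
rewrite ncellsS (leq_trans (_ : _ <= k.+1 * 2)%N)//; first by lia.
apply: leq_mul => //; rewrite branching.unlock.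
by rewrite (leq_trans _ (leq_addl _ _))// (@leq_exp2l 64 0 2).
Qed.

Lemma measurable_lifts k : measurable (lifts k).
Proof.
have -> : lifts k = `]-oo, 0[ `|`
    \bigcup_i `[i%:R * len k, i%:R * len k + len k.+1[%classic :> set R.
  apply/seteqP; split=> x.
    rewrite /lifts/= lifted_itv => lx; have [x0|x0] := ltP x 0.
      by left; rewrite /= in_itv.
    right; exists (cell k x) => //=; rewrite in_itv/= lx andbT.
    by have /andP[] := cell_itv k x0.
  move=> [|[i _]]; rewrite /= in_itv/= /lifts/= lifted_itv.
    move=> x0; rewrite (lt_trans x0)// ltr_wpDl ?len_gt0//.
    by rewrite mulr_ge0// ltW// len_gt0.
  move=> /andP[ix xi]; rewrite (@cell_unique _ k x i)// ix/= (lt_le_trans xi)//.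
  have := lenS_le (R := R) k; have := len_gt0 (R := R) k.
  by rewrite -[i.+1%:R]natr1 mulrDl mul1r; lra.
by apply: measurableU => //; exact: bigcupT_measurable.
Qed.

Lemma measurable_base k : measurable_fun setT (base k : R -> R).
Proof.
apply: measurable_sum => j.
rewrite (_ : (fun x => _) = (fun x => hgt j * \1_(lifts j) x)).
  apply: measurable_funM => //; apply: measurable_indic; exact: measurable_lifts.
apply/funext => x; rewrite indicE mulr_natr; congr (_ *+ nat_of_bool _).
by apply/idP/idP; rewrite inE.
Qed.

Lemma measurable_height : measurable_fun setT (height : R -> R).
Proof.
by apply: (measurable_fun_cvg measurable_base) => x _; exact: cvg_base.
Qed.

Lemma measurable_strip (D : set R) : measurable D ->
  measurable (fst @^-1` D : set (R * R)).
Proof. by move=> mD; rewrite -[X in measurable X]setTI; exact: measurable_fst. Qed.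

Lemma measurable_jump_graph : measurable jump_graph.
Proof.
have -> : jump_graph = (fst @^-1` `[0, 1[) `&`
    (fun z : R * R => z.2 - height z.1) @^-1` [set 0].
  apply/seteqP; split=> z.
    by move=> [z01 zh]; split; rewrite /= ?in_itv// zh subrr.
  move=> [/=]; rewrite in_itv/= => z01 /eqP; rewrite subr_eq0 => /eqP zh.
  by split.
apply: measurableI; first exact: measurable_strip.
rewrite -[X in measurable X]setTI.
have : measurable_fun setT (fun z : R * R => z.2 - height z.1).
  apply: measurable_funB; first exact: measurable_snd.
  apply: measurableT_comp; [exact: measurable_height|exact: measurable_fst].
by apply.
Qed.

Lemma cell_diam k i :
  (eucl_diam [set z | jump_graph z /\ cell k z.1 = i] <= (2 * len k)%:E)%E.
Proof.
have l0 := len_gt0 (R := R) k.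
apply: eucl_diam_le; first by lra.
move=> x y [[/andP[x0 x1] xh] xi] [[/andP[y0 y1] yh] yi].
apply: (@le_trans _ _ (len k + 2 * hgt k)); last by rewrite /hgt; lra.
apply: eucl_dist_le.
  have := cell_itv k x0; have := cell_itv k y0; rewrite xi yi -natr1 mulrDl mul1r.
  by move=> /andP[h1 h2] /andP[h3 h4]; rewrite ler_norml; apply/andP; split; lra.
have := base_le_height k x.1; have := height_le_base k x.1.
have := base_le_height k y.1; have := height_le_base k y.1.
have <- : base k x.1 = base k y.1 by apply: cell_eq_base => //; rewrite xi yi.
by rewrite xh yh => h1 h2 h3 h4; rewrite ler_norml; apply/andP; split; lra.
Qed.

(** Covering by the cells of a late generation [k], whose diameters are at most
    [2 * len k]. *)
Lemma hausdorff1_le_cells X (v : R) (s : nat -> seq nat) (K : nat) :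
  X `<=` jump_graph ->
  (forall k z, X z -> (K <= k)%N -> cell k z.1 \in s k) ->
  (forall e : R, 0 < e -> exists k0, forall k, (k0 <= k)%N ->
     (size (s k))%:R * len k <= v + e) ->
  (hausdorff1 X <= (2 * v)%:E)%E.
Proof.
move=> XE Xs sv; apply: ge_ereal_sup => _ [d /= d0 <-].
apply/lee_addgt0Pr => e e0.
have [k0 k0P] := sv _ (divr_gt0 e0 (ltr0Sn R 1) : 0 < e / 2).
have [k1 k1P] := len_lt (divr_gt0 d0 (ltr0Sn R 1) : 0 < d / 2).
pose k := maxn K (maxn k0 k1).
have l0 := len_gt0 (R := R) k.
have kd : 2 * len k <= d.
  by have := k1P k; rewrite !leq_max leqnn !orbT => /(_ isT); lra.
apply: (@le_trans _ _ ((size (s k))%:R * (2 * len k))%:E).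
  pose A i := [set z | jump_graph z /\ cell k z.1 = i].
  apply: (@hausdorff_content_le_size _ _ _ A).
  - by rewrite kd andbT; lra.
  - by move=> i; exact: cell_diam.
  - move=> z Xz; exists (cell k z.1); last by split=> //; exact: XE.
    by apply: Xs => //; rewrite leq_maxl.
rewrite -EFinD lee_fin.
have := k0P k; rewrite !leq_max leqnn !orbT => /(_ isT).
lra.
Qed.

(** An interval of length [w] meets at most [w / len k + 2] cells; the two extra
    cells disappear as [k] grows. *)
Lemma mu_strip a w : 0 <= w -> (mu (fst @^-1` `[a, (a + w)%R]) <= (2 * w)%:E)%E.
Proof.
move=> w0; set s := fun k => iota (cell k a) (Num.truncn (w * (ncells k)%:R)).+2.
apply: (@hausdorff1_le_cells _ w s 0); first by move=> z [].
- move=> k z [/=]; rewrite in_itv/= => /andP[az za] [/andP[z0 _] _] _.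
  rewrite mem_iota; have N0 := ncellsR_gt0 (R := R) k.
  have caz : (cell k a <= cell k z.1)%N by apply: le_truncn; rewrite ler_wpM2r// ltW.
  rewrite caz/= -(@ltr_nat R) natrD -addn2 natrD.
  have [h1 _] := andP (truncn_itv (mulr_ge0 z0 (ltW N0)) : _ <= _ < _).
  have := truncnS_gt (a * (ncells k)%:R); have := truncnS_gt (w * (ncells k)%:R).
  have : z.1 * (ncells k)%:R <= (a + w) * (ncells k)%:R by rewrite ler_wpM2r// ltW.
  by rewrite /cell -!natr1 mulrDl; move: h1; lra.
- move=> e e0; have [k0 k0P] := len_lt (divr_gt0 e0 (ltr0Sn R 1) : 0 < e / 2).
  exists k0 => k /k0P le; rewrite size_iota -addn2 natrD mulrDl.
  have N0 := ncellsR_gt0 (R := R) k; have l0 := len_gt0 (R := R) k.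
  have : (Num.truncn (w * (ncells k)%:R))%:R * len k <= w.
    by rewrite ler_pdivrMr// truncn_le ?mulr_ge0// ltW.
  lra.
Qed.

(** Each of the at most [w / len k + 2 <= 3 * w / len k] cells of generation [k]
    contributes its first child, an interval of length [eps k * len k]. *)
Lemma mu_strip_lifts k a w : len k <= w ->
  (mu (fst @^-1` (`[a, (a + w)%R]%classic `&` lifts k)) <= (6 * eps k * w)%:E)%E.
Proof.
move=> kw; have N0 := ncellsR_gt0 (R := R) k; have l0 := len_gt0 (R := R) k.
have w0 : 0 <= w by rewrite (le_trans _ kw)// ltW.
pose m := (Num.truncn (w * (ncells k)%:R)).+2.
pose left i := (cell k a + i)%:R * len k : R.
pose F i := fst @^-1` `[left i, left i + len k.+1] `&` jump_graph.
have cov : fst @^-1` (`[a, (a + w)]%classic `&` lifts k) `&` jump_graph `<=`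
    \big[setU/set0]_(i < m) F i.
  move=> z [/= []]; rewrite in_itv/= => /andP[az za] lz Ez; have [/andP[z0 _] _] := Ez.
  have caz : (cell k a <= cell k z.1)%N by apply: le_truncn; rewrite ler_wpM2r// ltW.
  have im : (cell k z.1 - cell k a < m)%N.
    rewrite ltn_subLR// -(@ltr_nat R) natrD /m -addn2 natrD.
    have [h1 _] := andP (truncn_itv (mulr_ge0 z0 (ltW N0)) : _ <= _ < _).
    have := truncnS_gt (a * (ncells k)%:R); have := truncnS_gt (w * (ncells k)%:R).
    have : z.1 * (ncells k)%:R <= (a + w) * (ncells k)%:R by rewrite ler_wpM2r// ltW.
    by rewrite /cell -!natr1 mulrDl; move: h1; lra.
  rewrite -bigcup_mkord; exists (cell k z.1 - cell k a)%N => //; split=> //=.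
  rewrite /F /= in_itv/= /left subnKC//; have /andP[-> _]/= := cell_itv k z0.
  by apply: ltW; rewrite -lifted_itv.
apply: (@le_trans _ _ (\sum_(i < m) (2 * len (R := R) k.+1)%:E)%E).
  apply: le_trans (le_hausdorff1 cov) _.
  apply: le_trans (outer_measure_subadditive _ _ _) _.
  by apply: lee_sum => i _; apply: mu_strip; rewrite ltW// len_gt0.
rewrite sumEFin lee_fin sumr_const card_ord -[leLHS]mulr_natl lenS /m -addn2 natrD.
have : (Num.truncn (w * (ncells k)%:R))%:R * len k <= w.
  by rewrite ler_pdivrMr// truncn_le ?mulr_ge0// ltW.
move: (_%:R) => t tw; have e0 := eps_gt0 (R := R) k.
have : eps k * (t * len k) <= eps k * w by rewrite ler_wpM2l// ltW.
have : eps k * len k <= eps k * w by rewrite ler_wpM2l// ltW.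
lra.
Qed.

Lemma hausdorff1_jump_graph_lty : (hausdorff1 jump_graph < +oo)%E.
Proof.
have : (mu (fst @^-1` `[0%R, (0 + 1)%R]) <= (2 * 1)%:E)%E by exact: mu_strip.
rewrite /hausdorff1_restr (_ : _ `&` _ = jump_graph).
  by move=> /le_lt_trans; apply; rewrite ltry.
apply/seteqP; split=> [z []//|z Ez]; split=> //=.
by have [/andP[z0 z1] _] := Ez; rewrite in_itv/= z0 add0r ltW.
Qed.

Lemma mu_ge_projection (B : set (R * R)) (a b : R) :
  (forall t, a <= t < b -> 0 <= t < 1 /\ B (t, height t)) ->
  (((b - a) / 2)%:E <= mu B)%E.
Proof.
move=> aB; apply: hausdorff1_ge_projection => t /aB[t01 Bt].
by exists (t, height t).
Qed.

Lemma hausdorff1_jump_graph_gt0 : (0 < hausdorff1 jump_graph)%E.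
Proof.
have : (((1 - 0) / 2)%:E <= mu setT)%E by apply: mu_ge_projection => t t01.
rewrite /hausdorff1_restr setTI; apply: lt_le_trans.
by rewrite lte_fin; lra.
Qed.

End graph_measure.

(** * Almost every point is lifted infinitely often *)

(** The indices of the cells of generation [K + n] whose ancestors of generation
    greater than [K], themselves included, are not first children: the number of
    a child among its siblings is [d.+1]. *)
Fixpoint grounded K n : seq nat :=
  if n is n'.+1 then
    [seq (branching (K + n') * i + d.+1)%N |
      i <- grounded K n', d <- iota 0 (branching (K + n')).-1]
  else iota 0 (ncells K).

Lemma size_grounded K n :
  (size (grounded K n) * (branching (K + n)).-1 = ncells (K + n) * (branching K).-1)%N.
Proof.
elim: n => [|n ih]; first by rewrite /= size_iota addn0.
rewrite [grounded _ _]/= size_allpairs size_iota addnS ih ncellsS.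
rewrite mulnAC; congr (_ * _)%N.
by rewrite branching.unlock addSn.
Qed.

Section graph_ae.
Context {R : realType}.
Notation mu := (hausdorff1_restr (@jump_graph R)).

Lemma cell_grounded K n (x : R) : 0 <= x < 1 ->
  (forall k, (K <= k)%N -> ~~ lifted k x) -> cell (K + n) x \in grounded K n.
Proof.
move=> x01 nx; have /andP[x0 _] := x01; elim: n => [|n ih].
  by rewrite /= addn0 mem_iota cell_lt.
rewrite addnS [grounded _ _]/=; apply/allpairsP.
set b := branching (K + n).
have : ~~ (b %| cell (K + n).+1 x)%N by rewrite -liftedE// nx// leq_addr.
rewrite /dvdn -lt0n => r0.
exists (cell (K + n) x, (cell (K + n).+1 x %% b).-1); split=> //=.
  rewrite mem_iota add0n /=; have := ltn_pmod (cell (K + n).+1 x) (branching_gt0 (K + n)).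
  by move: r0; rewrite -/b; lia.
by rewrite (cellS (K + n) x0) prednK// mulnC -divn_eq.
Qed.

(** The proportion of the cells of generation [k] that survive is
    [\prod_(K <= j < k) (1 - eps j)], a telescoping product that tends to [0]. *)
Lemma finitely_lifted_null :
  hausdorff1 [set z | @jump_graph R z /\
    exists K, forall k, (K <= k)%N -> ~~ lifted k z.1] = 0%E.
Proof.
set A := [set z | _].
pose F K : set (R * R) :=
  [set z | jump_graph z /\ forall k, (K <= k)%N -> ~~ lifted k z.1].
have -> : A = \bigcup_K F K.
  apply/seteqP; split=> [z [Ez [K Kz]]|z [K _ [Ez Kz]]]; first by exists K.
  by split=> //; exists K.
apply/eqP; rewrite eq_le hausdorff1_ge0 andbT.
apply: le_trans (hausdorff1_sigma_subadditive F) _.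
rewrite eseries0// => K _ _; apply/eqP; rewrite eq_le hausdorff1_ge0 andbT.
rewrite -[0%E](congr1 EFin (mulr0 2)).
apply: (@hausdorff1_le_cells _ _ _ (fun k => grounded K (k - K)) K); first by move=> z [].
  by move=> k z [[z01 _] Kz] Kk; rewrite -{1}(subnKC Kk) cell_grounded.
move=> e e0; set b : R := (branching K)%:R.
have b0 : 0 < b by rewrite ltr0n branching_gt0.
exists (K + (Num.truncn (b / e)).+1)%N => k Kk; rewrite add0r.
have kK : (K <= k)%N by rewrite (leq_trans _ Kk)// leq_addr.
rewrite ler_pdivrMr ?ncellsR_gt0//.
have := size_grounded K (k - K); rewrite subnKC//; set s := size _.
move=> /(congr1 (GRing.natmul (1 : R))).
rewrite !natrM.
have bk : b <= e * (branching k).-1%:R.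
  rewrite mulrC -ler_pdivrMr//; apply: le_trans (ltW (truncnS_gt _)) _.
  rewrite ler_nat branching.unlock.
  have := expn_gt0 64 2; move: (64 ^ 2)%N Kk; move: (Num.truncn _) => t m Kk m0.
  by lia.
have bk0 : 0 < (branching k).-1%:R :> R by rewrite -(pmulr_rgt0 _ e0) (lt_le_trans b0).
have bb : (branching K).-1%:R <= b by rewrite ler_nat leq_pred.
have N0 := ncellsR_gt0 (R := R) k.
move=> h; rewrite -(ler_pM2r bk0) h.
rewrite [e * _]mulrC -[leRHS]mulrA ler_wpM2l ?(ltW N0)//.
exact: le_trans bk.
Qed.

(** * Summability of the liftings *)

(** The function [x `^ (- t)] is convex: its decrease over a unit step is at least
    its slope at the end of the step. The inequality comes from
    [1 + y <= expR y] and [ln (1 + y) <= y]. *)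
Lemma eps_powR_telescope (t : R) k : 0 < t ->
  t * eps k.+1 `^ (1 + t) <= eps k `^ t - eps k.+1 `^ t :> R.
Proof.
move=> t0; have e0 := eps_gt0 (R := R) k; have e1 := eps_gt0 (R := R) k.+1.
rewrite powRD ?(gt_eqF e1) ?implybT// powRr1 ?(ltW e1)//.
rewrite lerBrDr mulrA -[X in _ + X]mul1r -mulrDl.
have -> : eps k `^ t = (eps k / eps k.+1) `^ t * eps k.+1 `^ t :> R.
  rewrite -powRM ?ltW ?divr_gt0//; congr (_ `^ _).
  by rewrite divfK// gt_eqF.
rewrite ler_wpM2r ?powR_ge0//.
have q : eps k.+1 / eps k = 1 + - eps k.+1 :> R.
  rewrite /eps branching.unlock invrK addSn -natr1; set m := (_%:R).
  have m0 : 0 < m by rewrite ltr0n addn_gt0 orbC expn_gt0.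
  have m1 : m + 1 != 0 by rewrite gt_eqF// addr_gt0.
  have mn : m != 0 by rewrite gt_eqF.
  by clearbody m; field; rewrite ?mn ?m1.
rewrite {1}/powR gt_eqF ?divr_gt0// (le_trans _ (expR_ge1Dx _))//.
rewrite addrC lerD2l ler_pM2l// -[_ / _]invrK invf_div lnV ?posrE ?divr_gt0//.
rewrite q lerNr le_ln1Dx// ltrN2 (le_lt_trans (eps_le _))//.
by lra.
Qed.

Lemma eps_powR_summable (s : R) : 1 < s ->
  (\sum_(k <oo) (eps k `^ s)%:E < +oo)%E.
Proof.
move=> s1; set t := s - 1; have t0 : 0 < t by rewrite subr_gt0.
have ts : 1 + t = s by rewrite addrC subrK.
apply: (@le_lt_trans _ _ ((eps 0 `^ s + t^-1 * eps 0 `^ t)%:E)); last exact: ltry.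
have e0 k : 0 <= eps k `^ s :> R := powR_ge0 _ _.
apply: lime_le; first by apply: is_cvg_nneseries => *; rewrite lee_fin.
apply: nearW => n.
rewrite sumEFin lee_fin.
suff h m : \sum_(0 <= k < m.+1) eps k `^ s <=
    eps 0 `^ s + t^-1 * (eps 0 `^ t - eps m `^ t) :> R.
  case: n => [|n].
    by rewrite big_nil addr_ge0// mulr_ge0 ?powR_ge0// invr_ge0 ltW.
  apply: le_trans (h n) _; rewrite lerD2l ler_wpM2l ?invr_ge0 ?(ltW t0)//.
  by rewrite gerBl powR_ge0.
elim: m => [|m ih]; first by rewrite big_nat1 subrr mulr0 addr0.
rewrite big_nat_recr//; have := eps_powR_telescope m t0.
rewrite -ler_pdivlMl// {1}ts => h.
apply: le_trans (lerD ih h) _.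
rewrite -addrA -mulrDr.
by rewrite (_ : _ - _ + (_ - _) = eps 0 `^ t - eps m.+1 `^ t)//; ring.
Qed.

Lemma mu_lifts k : (mu (fst @^-1` (lifts k)) <= (6 * eps k)%:E)%E.
Proof.
have : (mu (fst @^-1` (`[0%R, (0 + 1)%R]%classic `&` lifts k)) <= (6 * eps k * 1)%:E)%E.
  by apply: mu_strip_lifts; rewrite -(len0 (R := R)) le_len.
rewrite mulr1; apply: le_trans; apply: le_hausdorff1 => z [lz Ez].
have [/andP[z0 z1] _] := Ez.
by split=> //; split=> //=; rewrite in_itv/= z0 add0r ltW.
Qed.

Definition lift_sum (x : R) : \bar R :=
  (\sum_(k <oo) (Num.sqrt (eps k) * \1_(lifts k) x)%:E)%E.

(** The integral of the sum is at most a multiple of the sum of [eps k `^ (3 / 2)]. *)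
Lemma lift_sum_ae :
  exists N, [/\ measurable N, hausdorff1 N = 0%E &
    forall z, jump_graph z -> ~ N z -> (lift_sum z.1 < +oo)%E].
Proof.
pose f k (z : R * R) : \bar R := (Num.sqrt (eps k) * \1_(fst @^-1` (lifts k)) z)%:E.
have mL k : measurable (fst @^-1` (lifts k) : set (R * R)).
  by apply: measurable_strip; exact: measurable_lifts.
have f0 k z : (0 <= f k z)%E by rewrite lee_fin mulr_ge0// sqrtr_ge0.
have mf k : measurable_fun setT (f k).
  by apply/measurable_EFinP; apply: measurable_funM => //; exact: measurable_indic.
pose S z := (\sum_(k <oo) f k z)%E.
have mS : measurable_fun setT S by exact: ge0_emeasurable_sum.
have S0 z : (0 <= S z)%E by apply: nneseries_ge0.
have intS : mu.-integrable setT S.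
  apply/integrableP; split=> //.
  under eq_integral do rewrite gee0_abs//.
  rewrite integral_nneseries//.
  apply: (@le_lt_trans _ _ (\sum_(k <oo) (6%:E * (eps k `^ (3 / 2))%:E))%E); last first.
    rewrite nneseriesZl//; last by move=> *; rewrite lee_fin powR_ge0.
    by rewrite lte_mul_pinfty// eps_powR_summable//; lra.
  apply: lee_nneseries => [k _ _|k _]; first exact: integral_ge0.
  have -> : f k = fun z =>
      ((Num.sqrt (eps k))%:E * (\1_(fst @^-1` (lifts k)) z)%:E)%E.
    by apply/funext => z; rewrite -EFinM.
  rewrite ge0_integralZl ?lee_fin ?sqrtr_ge0//; last first.
    by apply/measurable_EFinP; exact: measurable_indic.
  rewrite integral_indic// setIT.
  apply: (@le_trans _ _ ((Num.sqrt (eps k))%:E * (6 * eps k)%:E)%E).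
    by rewrite lee_wpmul2l// ?lee_fin ?sqrtr_ge0//; exact: mu_lifts.
  have e0 := eps_gt0 (R := R) k.
  rewrite -EFinM lee_fin (_ : 3 / 2 = 2^-1 + 1 :> R); last by lra.
  rewrite powRD ?(gt_eqF e0) ?implybT// powRr1 ?(ltW e0)// powR12_sqrt ?(ltW e0)//.
  by lra.
have [N [mN N0 SN]] := integrable_ae measurableT intS.
exists (N `&` jump_graph); split=> //.
  by apply: measurableI => //; exact: measurable_jump_graph.
move=> z Ez NEz; have Nz : ~ N z by move=> Nz; apply: NEz.
have : S z \is a fin_num.
  by apply: contrapT => Sz; apply: Nz; apply: SN => /(_ Logic.I).
rewrite ge0_fin_numE// /S /lift_sum; congr (_ < +oo)%E.
Qed.

End graph_ae.

Section integral_monotone.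
Local Open Scope ereal_scope.

(** The integral of a nonnegative function is a supremum over simple functions
    below it, so that domination needs no measurability. This serves integrands
    such as [beta_tilde], an infimum over uncountably many lines. *)
Lemma ge0_le_integral_nonmeasurable d (T : measurableType d) (R : realType)
    (nu : {measure set T -> \bar R}) (D : set T) (f g : T -> \bar R) :
  (forall x, D x -> 0 <= f x) -> (forall x, D x -> f x <= g x) ->
  \int[nu]_(x in D) f x <= \int[nu]_(x in D) g x.
Proof.
move=> f0 fg; rewrite !ge0_integralE//; last first.
  by move=> x Dx; apply: le_trans (f0 _ Dx) (fg _ Dx).
apply: ge_ereal_sup => _ [h hf <-]; apply: ereal_sup_ubound; exists h => //= x.
by apply: le_trans (hf x) _; exact: lee_restrict.
Qed.

End integral_monotone.

(** * The graph is purely unrectifiable *)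

Section lipschitz_gaps.
Context {R : realType}.
Notation mu := (hausdorff1_restr (@jump_graph R)).
Variables (f : R -> R * R) (C N : R).
Hypothesis C0 : 0 < C.
Hypothesis fC : forall s t : R, eucl_dist (f s) (f t) <= C * `|s - t|.

Let dom : set R := [set t | - N <= t <= N /\ jump_graph (f t)].
Let visits k i : set R := [set t | [/\ dom t, lifted k (f t).1 & cell k (f t).1 = i]].
(** The time that [f] needs to leave the neighbourhood of a lifted piece in which
    [lifted_isolated] excludes other points of the graph. *)
Let gap k : R := hgt k * (1 - 2 * eps k) / C.
Let exit k i : R := sup (visits k i).

Let gap_gt0 k : 0 < gap k.
Proof.
rewrite divr_gt0// mulr_gt0 ?hgt_gt0//.
by have := eps_le (R := R) k; lra.
Qed.

Let gap_geom k j : (k < j)%N -> gap j <= gap k / 2.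
Proof.
move=> kj; rewrite /gap [leRHS]mulrAC ler_wpM2r ?invr_ge0 ?(ltW C0)//.
have := le_len kj (R := R); have := lenS_le (R := R) k.
have := hgt_gt0 (R := R) k; have := hgt_gt0 (R := R) j; rewrite /hgt.
have := eps_le (R := R) k; have := eps_gt0 (R := R) j.
move: (len k) (len j) (len k.+1) (eps k) (eps j) => l l' l1 e e' e'0 ek l'0 l0 l1l l'l1.
have : 0 <= l' * e' by rewrite mulr_ge0 ?(ltW e'0)//; lra.
have : l * e <= l * 64^-1 by rewrite ler_wpM2l//; lra.
lra.
Qed.

Let visits_stable k i s t : visits k i t -> dom s -> `|s - t| < gap k -> visits k i s.
Proof.
move=> [[tN [/andP[t0 t1] ht]] lt it] sA; have [sN [/andP[s0 s1] hs]] := sA.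
rewrite distrC ltr_pdivlMr// mulrC => st.
have {st}st := le_lt_trans (fC t s) st.
have hst : `|height (f t).1 - height (f s).1| < hgt k * (1 - 2 * eps k).
  by rewrite -ht -hs; apply: le_lt_trans st; exact: ler_dist2.
have xst : `|(f t).1 - (f s).1| < hgt k.
  apply: le_lt_trans (ler_dist1 _ _) (lt_le_trans st _).
  rewrite ger_pMr ?hgt_gt0//.
  by have := eps_gt0 (R := R) k; lra.
have cst := lifted_isolated t0 s0 lt xst hst.
split=> //; first by rewrite -(height_sep hst).
by rewrite -it; symmetry; exact: (cell_eq_le t0 s0 (leqnSn k)).
Qed.

Let visits_sup k i : visits k i !=set0 -> has_sup (visits k i).
Proof. by move=> h; split=> //; exists N => t [[/andP[]]]. Qed.

Let le_exit k i t : visits k i t -> t <= exit k i.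
Proof.
by move=> vt; apply: sup_upper_bound => //; apply: visits_sup; exists t.
Qed.

Let exit_adherent k i e : visits k i !=set0 -> 0 < e ->
  exists2 t, visits k i t & exit k i - e < t.
Proof. by move=> h e0; apply: sup_adherent => //; exact: visits_sup. Qed.

Let dom_gap k i s : visits k i !=set0 -> dom s -> exit k i < s -> exit k i + gap k <= s.
Proof.
move=> vki sA ts; rewrite -lerBrDr; apply: ge_sup => // t vt.
rewrite leNgt; apply/negP => tgap.
have := le_exit vt; suff : visits k i s by move/le_exit; lra.
apply: (visits_stable vt) => //.
rewrite ltr_norml; have := le_exit vt; have := gap_gt0 k; lra.
Qed.

Let exit_gap k i k' i' : visits k i !=set0 -> visits k' i' !=set0 ->
  exit k i < exit k' i' -> exit k i + gap k <= exit k' i'.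
Proof.
move=> v v'; rewrite -subr_gt0 => e0.
have [t v't et] := exit_adherent v' e0.
apply: le_trans (le_exit v't); apply: dom_gap => //; first by have [] := v't.
by apply: le_lt_trans et; lra.
Qed.

(** Only the part between [gap k / 4] and [gap k / 2] is retained: if visits of
    different stages end at the same time, these parts are still disjoint, because
    [gap] decreases by a factor of at least [2] from a stage to the next. *)
Let Gap k i : set R :=
  [set t | visits k i !=set0 /\ exit k i + gap k / 4 < t < exit k i + gap k / 2].

(** Two times of last visit either coincide or are separated by the gap of the
    earlier one, by [exit_gap]. *)
Let Gap_disjoint k i k' i' : (k <= k')%N ->
  Gap k i `&` Gap k' i' !=set0 -> k = k' /\ i = i'.
Proof.
move=> kk' [t [[v /andP[t1 t2]] [v' /andP[t1' t2']]]].
have g0 := gap_gt0 k; have g0' := gap_gt0 k'.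
have [ee|ee|ee] := ltgtP (exit k i) (exit k' i').
- by exfalso; have := exit_gap v v' ee; lra.
- by exfalso; have := exit_gap v' v ee; lra.
have kE : k = k'.
  apply/eqP; rewrite eqn_leq kk'/= leqNgt; apply/negP => /gap_geom; lra.
subst k'; split=> //.
have [s vs es] := exit_adherent v g0; have [s' vs' es'] := exit_adherent v' g0.
have [] := visits_stable vs (let: And3 h _ _ := vs' in h) => [|_ _ <-].
  by have := le_exit vs; have := le_exit vs'; rewrite ltr_norml; lra.
by have [] := vs'.
Qed.

Let measurable_Gap k i : measurable (Gap k i).
Proof.
have [v|v] := pselect (visits k i !=set0).
  rewrite (_ : Gap k i = `](exit k i + gap k / 4), (exit k i + gap k / 2)[%classic)//.
  by apply/seteqP; split=> t; rewrite /= in_itv/= => // -[].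
by rewrite (_ : Gap k i = set0)//; apply/seteqP; split=> t // [].
Qed.

Let lebesgue_Gap k i : visits k i !=set0 ->
  lebesgue_measure (Gap k i) = (gap k / 4)%:E.
Proof.
move=> v; rewrite (_ : Gap k i = `](exit k i + gap k / 4), (exit k i + gap k / 2)[%classic).
  have g0 := gap_gt0 k; rewrite lebesgue_measure_itv/= lte_fin ifT; last by lra.
  by rewrite -EFinB; congr EFin; lra.
by apply/seteqP; split=> t; rewrite /= in_itv/= => // -[].
Qed.

Let Gaps k := \bigcup_i Gap k i.

Let trivIset_Gap k : trivIset setT (Gap k).
Proof. by move=> i j _ _ /(Gap_disjoint (leqnn k))[]. Qed.

Let trivIset_Gaps : trivIset setT Gaps.
Proof.
move=> k k' _ _ [t [[i _ it] [i' _ it']]].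
have [/Gap_disjoint|/ltnW/Gap_disjoint] := leqP k k'.
  by move=> /(_ i i')[]//; exists t.
by move=> /(_ i' i)[]//; exists t.
Qed.

Let measurable_Gaps k : measurable (Gaps k).
Proof. exact: bigcupT_measurable. Qed.

Let Gaps_summable : (\sum_(k <oo) lebesgue_measure (Gaps k) < +oo)%E.
Proof.
rewrite -measure_semi_bigcup//; last exact: bigcupT_measurable.
apply: (@le_lt_trans _ _ (lebesgue_measure `[(- N)%R, (N + gap 0)%R])).
  apply: le_measure; rewrite ?inE//; first exact: bigcupT_measurable.
  move=> t [k _ [i _ [v /andP[t1 t2]]]]; rewrite /= in_itv/=.
  have eN : exit k i <= N by apply: ge_sup => // s [[/andP[]]].
  have Ne : - N <= exit k i.
    by have [s vs] := v; apply: le_trans (le_exit vs); have [[/andP[]]] := vs.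
  have g0 := gap_gt0 k.
  have gk : gap k <= gap 0.
    by case: (k) => // j; have := gap_geom (ltn0Sn j); have := gap_gt0 0; lra.
  by apply/andP; split; lra.
by rewrite lebesgue_measure_itv/=; case: ifPn => _; rewrite ?ltry// -EFinB ltry.
Qed.

Let Cell k i : set (R * R) :=
  [set z | visits k i !=set0 /\ i%:R * len k <= z.1 <= i%:R * len k + len k.+1].

Let Cells k := \bigcup_i Cell k i.

Let measurable_Cell k i : measurable (Cell k i).
Proof.
have [v|v] := pselect (visits k i !=set0).
  rewrite (_ : Cell k i = fst @^-1` `[i%:R * len k, (i%:R * len k + len k.+1)]).
    exact: measurable_strip.
  by apply/seteqP; split=> t; rewrite /= in_itv/= => // -[].
by rewrite (_ : Cell k i = set0)//; apply/seteqP; split=> t // [].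
Qed.

(** As [k] grows, the mass is even of smaller order than the gap, but summability
    only requires a bound by a multiple of the gap. *)
Let mu_Cell k i : (mu (Cell k i) <= (4 * C)%:E * lebesgue_measure (Gap k i))%E.
Proof.
have [v|v] := pselect (visits k i !=set0); last first.
  have -> : Cell k i = set0 by apply/seteqP; split=> t // [].
  by rewrite measure0 mule_ge0// lee_fin mulr_ge0// ltW.
apply: (@le_trans _ _ (mu (fst @^-1` `[(i%:R * len k)%R, (i%:R * len k + len k.+1)%R]))).
  by apply: le_hausdorff1 => z [[_ zi] Ez]; split=> //; rewrite /= in_itv.
apply: le_trans (mu_strip _ (ltW (len_gt0 _))) _.
rewrite lebesgue_Gap// -EFinM lee_fin.
have -> : 4 * C * (gap k / 4) = hgt k * (1 - 2 * eps k).
  by rewrite /gap; field; rewrite gt_eqF.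
rewrite lenS; have := eps_le (R := R) k; have := len_gt0 (R := R) k; rewrite /hgt.
move: (len k) (eps k) => l e l0 e1.
have : l * e <= l * 64^-1 by rewrite ler_wpM2l// ltW.
lra.
Qed.

Let mu_Cells k : (mu (Cells k) <= (4 * C)%:E * lebesgue_measure (Gaps k))%E.
Proof.
apply: (@le_trans _ _ (\sum_(i <oo) mu (Cell k i))%E).
  by apply: measure_sigma_subadditive => //; exact: bigcupT_measurable.
rewrite measure_semi_bigcup; [|exact: measurable_Gap|exact: trivIset_Gap|
  exact: measurable_Gaps].
rewrite -nneseriesZl; last by move=> *; exact: measure_ge0.
by apply: lee_nneseries => [i _ _|i _]; [exact: measure_ge0|exact: mu_Cell].
Qed.

Lemma lipschitz_segment_null :
  hausdorff1 (jump_graph `&` [set f t | t in [set t | - N <= t <= N]]) = 0%E.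
Proof.
have limsup0 : mu (lim_sup_set Cells) = 0%E.
  apply: lim_sup_set_cvg0; first by move=> k; exact: bigcupT_measurable.
  apply: (@le_lt_trans _ _ (\sum_(k <oo) (4 * C)%:E * lebesgue_measure (Gaps k))%E).
    by apply: lee_nneseries => [k _ _|k _]; [exact: measure_ge0|exact: mu_Cells].
  rewrite nneseriesZl//.
  by rewrite lte_mul_pinfty// lee_fin mulr_ge0// ltW.
apply/eqP; rewrite eq_le hausdorff1_ge0 andbT.
pose X := [set z | @jump_graph R z /\ exists K, forall k, (K <= k)%N -> ~~ lifted k z.1].
apply: (@le_trans _ _ (hausdorff1 (X `|` (lim_sup_set Cells `&` jump_graph)))).
  apply: le_hausdorff1 => z [Ez [t tN ft]]; rewrite -{}ft in Ez *.
  have [fl|nfl] := pselect (exists K, forall k, (K <= k)%N -> ~~ lifted k (f t).1).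
    by left.
  right; split=> // n _; apply: contrapT => nC; apply: nfl; exists n => k nk.
  apply/negP => lk; apply: nC; exists k => //; exists (cell k (f t).1) => //.
  split; first by exists t.
  have [/andP[t0 _] _] := Ez; have /andP[-> _]/= := cell_itv k t0.
  by apply: ltW; rewrite -lifted_itv.
apply: le_trans (outer_measureU2 _ _ _) _.
by rewrite /= finitely_lifted_null add0e -/(hausdorff1_restr _ _) limsup0.
Qed.

End lipschitz_gaps.

Section unrectifiable.
Context {R : realType}.

Lemma lipschitz_image_null (f : R -> R * R) : lipschitz_curve f ->
  hausdorff1 (jump_graph `&` range f) = 0%E.
Proof.
move=> [C fC]; apply/eqP; rewrite eq_le hausdorff1_ge0 andbT.
pose F (n : nat) := jump_graph `&` [set f t | t in [set t | - n%:R <= t <= n%:R]].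
apply: (@le_trans _ _ (hausdorff1 (\bigcup_n F n))).
  apply: le_hausdorff1 => z [Ez [t _ ft]]; rewrite -{}ft in Ez *.
  exists (Num.truncn `|t|).+1 => //.
  by split=> //; exists t => //=; rewrite -ler_norml ltW// truncnS_gt.
apply: le_trans (hausdorff1_sigma_subadditive F) _.
rewrite eseries0// => n _ _; apply: (@lipschitz_segment_null _ _ (`|C| + 1)).
  by rewrite ltr_wpDl.
move=> s t; apply: le_trans (fC s t) _; rewrite ler_wpM2r//.
by have := ler_norm C; lra.
Qed.

Lemma jump_graph_purely_unrectifiable : purely_unrectifiable (@jump_graph R).
Proof.
move=> F FE [_ [f [fL f0]] _]; apply/eqP; rewrite eq_le hausdorff1_ge0 andbT.
apply: (@le_trans _ _ (hausdorff1 ((~` (\bigcup_i range (f i)) `&` F) `|`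
    \bigcup_i (jump_graph `&` range (f i))))).
  apply: le_hausdorff1 => z Fz.
  have [[i _ iz]|] := pselect ((\bigcup_i range (f i)) z); last by left.
  by right; exists i => //; split=> //; exact: FE.
apply: le_trans (outer_measureU2 _ _ _) _.
rewrite /= (f0 : hausdorff1 _ = _) add0e.
apply: le_trans (hausdorff1_sigma_subadditive _) _.
by rewrite eseries0// => i _ _; exact: lipschitz_image_null.
Qed.

End unrectifiable.

(** * Estimates of the coefficients *)

Section beta_general.
Context {R : realType} (mu : {measure set (R * R)%type -> \bar R}).

Lemma measurable_eucl_ball (z : R * R) (r : R) : measurable (eucl_ball z r).
Proof.
have -> : eucl_ball z r = (eucl_dist z) @^-1` `]-oo, r].
  by apply/seteqP; split=> y; rewrite /= in_itv.
rewrite -[X in measurable X]setTI.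
have : measurable_fun setT (eucl_dist z).
  apply: (@measurableT_comp _ _ _ _ _ _ (@Num.sqrt R) setT
    (fun y : R * R => (z.1 - y.1) ^+ 2 + (z.2 - y.2) ^+ 2)).
    by apply: continuous_measurable_fun; exact: sqrt_continuous.
  apply: measurable_funD; apply: measurable_funX; apply: measurable_funB => //.
by apply.
Qed.

Definition hline (b : R) : set (R * R) := [set z | z.2 = b].

Lemma affine_hline b : affine_line (hline b).
Proof.
exists (0, b), (1, 0); split; first by case=> /eqP; rewrite oner_eq0.
apply/seteqP; split=> [[y1 y2]|_ [t _ <-]]; rewrite /hline/=; last first.
  by rewrite mulr0 addr0.
by move=> ->; exists y1 => //; rewrite add0r mulr1 mulr0 addr0.
Qed.

Lemma dist_hline_ge0 y (b : R) : 0 <= dist_to_set y (hline b).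
Proof.
apply: lb_le_inf; first by exists (eucl_dist y (0, b)), (0, b).
by move=> _ [z _ <-]; exact: eucl_dist_ge0.
Qed.

Lemma dist_hline_le y (b : R) : dist_to_set y (hline b) <= `|y.2 - b|.
Proof.
have -> : `|y.2 - b| = eucl_dist y (y.1, b).
  by rewrite /eucl_dist/= subrr expr0n add0r sqrtr_sqr.
apply: ge_inf; first by exists 0 => _ [z _ <-]; exact: eucl_dist_ge0.
by exists (y.1, b).
Qed.

Lemma beta_tilde_ge0 (p : R) z r : (0 <= beta_tilde mu p z r)%E.
Proof. by apply: le_ereal_inf_tmp => _ [L _ <-]; exact: poweR_ge0. Qed.

(** The infimum is tested with a single horizontal line. *)
Lemma beta_tilde_sqr_le (p u v b : R) z r : 0 < p -> 0 <= u -> 0 < v ->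
  (\int[mu]_(y in eucl_ball z r) ((dist_to_set y (hline b) / r) `^ p)%:E <= u%:E)%E ->
  (v%:E <= mu (eucl_ball z r))%E ->
  (beta_tilde mu p z r ^+ 2 <= ((u / v) `^ (2 / p))%:E)%E.
Proof.
move=> p0 u0 v0 Iu vmu.
have I0 : (0 <= \int[mu]_(y in eucl_ball z r) ((dist_to_set y (hline b) / r) `^ p)%:E)%E.
  by apply: integral_ge0 => y _; rewrite lee_fin powR_ge0.
set I := (\int[_]_(_ in _) _)%E in Iu I0.
have uv0 : 0 <= u / v by rewrite divr_ge0// ltW.
have quot : (I / mu (eucl_ball z r) <= (u / v)%:E)%E.
  rewrite EFinM; apply: lee_pmul => //; first by rewrite inve_ge0 measure_ge0.
  rewrite (_ : (v^-1)%:E = v%:E^-1)%E; last by rewrite inver gt_eqF.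
  by rewrite lee_pV2 ?inE//= ?lee_fin ?(ltW v0)// measure_ge0.
have beta_le : (beta_tilde mu p z r <= ((u / v) `^ p^-1)%:E)%E.
  apply: (@le_trans _ _ ((I / mu (eucl_ball z r)) `^ p^-1)%E).
    by apply: ereal_inf_lbound; exists (hline b) => //; exact: affine_hline.
  rewrite -poweR_EFin; apply: gt0_ler_poweR => //; first by rewrite invr_ge0 ltW.
    by rewrite in_itv/= leey andbT mule_ge0// inve_ge0 measure_ge0.
  by rewrite in_itv/= leey andbT lee_fin.
rewrite [2 / p]mulrC powRrM powR_mulrn ?powR_ge0// EFin_expe !expe2.
by apply: lee_pmul => //; exact: beta_tilde_ge0.
Qed.

Lemma beta_tilde_sqr_le1 (p : R) z r : 0 < p -> 0 < r ->
  (0 < mu (eucl_ball z r) < +oo)%E -> (beta_tilde mu p z r ^+ 2 <= 1)%E.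
Proof.
move=> p0 r0 /andP[mu0 muoo].
have mufin : mu (eucl_ball z r) \is a fin_num by rewrite ge0_fin_numE ?measure_ge0.
have v0 : 0 < fine (mu (eucl_ball z r)) by rewrite fine_gt0// mu0.
have v00 := ltW v0; set m := fine _ in v0 v00.
rewrite (_ : 1%E = ((m / m) `^ (2 / p))%:E).
  apply: (beta_tilde_sqr_le (b := z.2)) => //; rewrite /m fineK//.
  apply: (@le_trans _ _ (\int[mu]_(y in eucl_ball z r) (1%:E))%E).
    apply: ge0_le_integral_nonmeasurable => y; first by rewrite lee_fin powR_ge0.
    move=> By; rewrite lee_fin.
    suff : (dist_to_set y (hline z.2) / r) `^ p <= 1 `^ p by rewrite powR1.
    apply: ge0_ler_powR.
    - exact: ltW.
    - by rewrite nnegrE divr_ge0 ?dist_hline_ge0// ltW.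
    - by rewrite nnegrE.
    - rewrite ler_pdivrMr// mul1r (le_trans (dist_hline_le _ _))//.
      by rewrite distrC (le_trans (ler_dist2 _ _)).
  by rewrite integral_cst ?mul1e//; exact: measurable_eucl_ball.
by rewrite divff ?gt_eqF// powR1.
Qed.

End beta_general.

Section beta_graph.
Context {R : realType}.
Implicit Types (x r a w b p : R) (k : nat).
Notation mu := (hausdorff1_restr (@jump_graph R)).
Notation ball x r := (eucl_ball (x, height x) r).

(** By [height_sep], two points of the graph whose heights differ by less than
    [sep k] have been lifted at the same stages up to [k]. *)
Definition sep k : R := hgt k * (1 - 2 * eps k).

Lemma sep_ge k : len k / 32 <= sep k :> R.
Proof.
rewrite /sep /hgt; have := eps_le (R := R) k; have := len_gt0 (R := R) k.
move: (len k : R) (eps k : R) => l e l0 e1.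
have : l * e <= l * 64^-1 by rewrite ler_wpM2l// ltW.
lra.
Qed.

Lemma sep_le k : sep k <= hgt k :> R.
Proof.
rewrite /sep ger_pMr ?hgt_gt0//.
by have := eps_gt0 (R := R) k; lra.
Qed.

Lemma sep_gt0 k : 0 < sep k :> R.
Proof. by apply: lt_le_trans (sep_ge k); rewrite divr_gt0// len_gt0. Qed.

(** Only the values [q <= 4] of [dist / r] matter below; on this range
    [q `^ p = 4 `^ p * (q / 4) `^ p] is at most [16 * (q / 4)]. *)
Lemma powR_le_linear p (q : R) : 1 <= p < 2 -> 0 <= q <= 4 -> q `^ p <= 4 * q.
Proof.
move=> /andP[p1 p2] /andP[q0 q4].
have -> : q = 4 * (q / 4) by field.
rewrite powRM ?divr_ge0// (_ : 4 * (4 * (q / 4)) = 4 ^+ 2 * (q / 4)); last by ring.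
apply: ler_pM; rewrite ?powR_ge0//.
  by rewrite -powR_mulrn// ler_powR//; lra.
move: q0; rewrite le_eqVlt => /predU1P[<-|q0].
  by rewrite mul0r powR0// gt_eqF// (lt_le_trans ltr01).
by apply: ge1r_powR => //; rewrite divr_gt0//= ler_pdivrMr ?mul1r.
Qed.

(** The line is at the height reached before stage [k]. The points lifted at stage
    [k] are at most [2 * hgt k] above it and have a mass of at most
    [6 * eps k * w]; the other ones are at most [2 * hgt k.+1 = 2 * eps k * hgt k]
    above it. *)
Lemma beta_numerator_le p x r k a w b : 1 <= p < 2 -> 0 < r -> hgt k <= 2 * r ->
  len k <= w ->
  (forall y, jump_graph y -> ball x r y -> a <= y.1 <= a + w /\ base k y.1 = b) ->
  (\int[mu]_(y in ball x r) ((dist_to_set y (hline b) / r) `^ p)%:E <=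
     (4 * eps k * len k * w / r)%:E)%E.
Proof.
move=> p12 r0 hr kw Bab.
have h0 := hgt_gt0 (R := R) k; have e0 := eps_gt0 (R := R) k.
have w0 : 0 <= w by rewrite (le_trans (ltW (len_gt0 _)) kw).
pose D1 : set (R * R) := fst @^-1` (`[a, (a + w)]%classic `&` lifts k).
pose D2 : set (R * R) := fst @^-1` `[a, (a + w)]%classic.
have mD1 : measurable D1.
  by apply: measurable_strip; apply: measurableI => //; exact: measurable_lifts.
have mD2 : measurable D2 by exact: measurable_strip.
have mE : measurable (~` @jump_graph R).
  by apply: measurableC; exact: measurable_jump_graph.
have mB := measurable_eucl_ball (x, height x) r.
pose c1 : R := 8 * hgt k / r; pose c2 : R := 8 * hgt k.+1 / r.
have c10 : 0 <= c1 by rewrite divr_ge0 ?(ltW r0)// mulr_ge0 ?(ltW h0).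
have c20 : 0 <= c2 by rewrite divr_ge0 ?(ltW r0)// mulr_ge0 ?(ltW (hgt_gt0 _)).
pose G1 y : \bar R := (c1%:E * (\1_D1 y)%:E)%E.
pose G2 y : \bar R := (c2%:E * (\1_D2 y)%:E)%E.
pose G3 y : \bar R := (+oo * (\1_(~` @jump_graph R) y)%:E)%E.
(* [G3] confines the estimate to the graph: its integral vanishes. *)
have G10 y : (0 <= G1 y)%E by rewrite mule_ge0 ?lee_fin.
have G20 y : (0 <= G2 y)%E by rewrite mule_ge0 ?lee_fin.
have G30 y : (0 <= G3 y)%E by rewrite mule_ge0 ?lee_fin.
have mI (D : set (R * R)) : measurable D ->
    measurable_fun (ball x r) (fun y => (\1_D y)%:E : \bar R).
  by move=> mD; apply/measurable_EFinP; exact: measurable_indic.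
have mG1 : measurable_fun (ball x r) G1 by apply: measurable_funeM; exact: mI.
have mG2 : measurable_fun (ball x r) G2 by apply: measurable_funeM; exact: mI.
have mG3 : measurable_fun (ball x r) G3 by apply: measurable_funeM; exact: mI.
apply: (@le_trans _ _ (\int[mu]_(y in ball x r) (G1 y + (G2 y + G3 y)))%E).
  apply: ge0_le_integral_nonmeasurable => y; first by rewrite lee_fin powR_ge0.
  move=> By; have [Ey|nEy] := pselect (jump_graph y); last first.
    have -> : G3 y = +oo%E by rewrite /G3 indicE mem_set// mule1.
    by rewrite addey ?addey ?leey// gt_eqF// (lt_le_trans _ (G20 _))// ltNye.
  have [/andP[ya yw] yb] := Bab y Ey By; have [_ yh] := Ey.
  have -> : G3 y = 0%E by rewrite /G3 indicE memNset ?mule0// => /(_ Ey).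
  rewrite adde0 /G1 /G2 indicE [X in (_ + _ * X)%E](_ : _ = 1%E); last first.
    by rewrite indicE mem_set// /D2/= in_itv/= ya yw.
  rewrite mule1.
  have l1 := base_le_height k y.1; have l2 := height_le_base k y.1.
  have l3 := height_le_base k.+1 y.1.
  have d0 := dist_hline_ge0 y b.
  have dle : dist_to_set y (hline b) <= height y.1 - base k y.1.
    by rewrite (le_trans (dist_hline_le _ _))// yh yb ger0_norm// subr_ge0 -yb.
  have q4 : 0 <= dist_to_set y (hline b) / r <= 4.
    by rewrite divr_ge0 ?(ltW r0)//= ler_pdivrMr//; lra.
  have pw := powR_le_linear p12 q4.
  have h10 := hgt_gt0 (R := R) k.+1.
  have [ly|nly] := boolP (lifted k y.1).
    rewrite mem_set ?mule1; last by split=> //=; rewrite in_itv/= ya yw.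
    rewrite -EFinD lee_fin (le_trans pw)// /c1 /c2 -mulrDl mulrA ler_pM2r ?invr_gt0//.
    lra.
  rewrite memNset ?mule0 ?add0e; last by move=> [_]; apply/negP.
  rewrite lee_fin (le_trans pw)// /c2 mulrA ler_pM2r ?invr_gt0//.
  by move: l3; rewrite baseS (negbTE nly) mulr0n addr0; lra.
rewrite ge0_integralD//; [|by move=> *; rewrite adde_ge0|exact: emeasurable_funD].
rewrite ge0_integralD//.
rewrite !ge0_integralZl ?lee_fin//; try exact: mI.
rewrite !integral_indic//.
rewrite [X in (+oo * X)%E](_ : _ = 0%E); last first.
  rewrite /= /hausdorff1_restr (_ : _ `&` _ `&` _ = set0) ?hausdorff1_set0//.
  by apply/seteqP; split=> y // [[]].
rewrite mule0 adde0.
have m1 : (mu (D1 `&` ball x r) <= (6 * eps k * w)%:E)%E.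
  by apply: le_trans (mu_strip_lifts a kw); apply: le_hausdorff1 => y [[? _] ?].
have m2 : (mu (D2 `&` ball x r) <= (2 * w)%:E)%E.
  by apply: le_trans (mu_strip a w0); apply: le_hausdorff1 => y [[? _] ?].
apply: (@le_trans _ _ (c1%:E * (6 * eps k * w)%:E + c2%:E * (2 * w)%:E)%E).
  by apply: leeD; apply: lee_wpmul2l; rewrite ?lee_fin.
rewrite -!EFinM -EFinD lee_fin le_eqVlt; apply/orP; left; apply/eqP.
by rewrite /c1 /c2 hgtS /hgt; field; rewrite gt_eqF.
Qed.

Lemma mu_ball_lty x r : (mu (ball x r) < +oo)%E.
Proof.
apply: le_lt_trans (@hausdorff1_jump_graph_lty R).
by apply: le_hausdorff1 => z [].
Qed.

(** One of the two halves of the interval [[lo, hi)] cut at [x] has at least half of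
    its length. *)
Lemma mu_ball_ge x r lo hi : 0 < r -> lo <= x < hi ->
  (forall t, lo <= t < hi -> 0 <= t < 1 /\ `|height x - height t| <= r / 2) ->
  ((Num.min (r / 2) ((hi - lo) / 2) / 2)%:E <= mu (ball x r))%E.
Proof.
move=> r0 /andP[lox xhi] xt; set m := Num.min _ _.
have m1 : m <= r / 2 by rewrite ge_min lexx.
have m2 : m <= (hi - lo) / 2 by rewrite ge_min lexx orbT.
have near t : lo <= t < hi -> `|x - t| <= m -> 0 <= t < 1 /\ ball x r (t, height t).
  move=> /xt[t01 xht] tm; split=> //.
  rewrite /eucl_ball/=.
  by apply: le_trans (@eucl_dist_le _ (x, height x) (t, height t) _ _ tm xht) _; lra.
have [xm|xm] := leP (x + m) hi.
  rewrite (_ : m = (x + m) - x); last by ring.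
  apply: mu_ge_projection => t /andP[t1 t2]; apply: near; last by rewrite ler_norml; lra.
  by apply/andP; split; lra.
rewrite [X in (X / 2)%:E](_ : m = x - (x - m)); last by ring.
apply: mu_ge_projection => t /andP[t1 t2]; apply: near; last by rewrite ler_norml; lra.
by apply/andP; split; lra.
Qed.

Lemma cell_window k (x t : R) : 0 <= x < 1 -> 
  (cell k x)%:R * len k <= t < (cell k x).+1%:R * len k ->
  0 <= t < 1 /\ cell k t = cell k x.
Proof.
move=> x01 txk; split; last exact: cell_unique txk.
have l0 := len_gt0 (R := R) k.
move: txk => /andP[t0 t1]; apply/andP; split.
  by apply: le_trans t0; rewrite mulr_ge0// ltW.
apply: lt_le_trans t1 _; rewrite ler_pdivrMr ?ncellsR_gt0// mul1r ler_nat.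
exact: cell_lt.
Qed.

Lemma mu_ball_ge_cell x r k : 0 <= x < 1 -> 0 < r -> 4 * hgt k <= r ->
  ((Num.min (r / 2) (len k / 2) / 2)%:E <= mu (ball x r))%E.
Proof.
move=> x01 r0 hr; have /andP[x0 _] := x01.
have := @mu_ball_ge x r ((cell k x)%:R * len k) ((cell k x).+1%:R * len k) r0.
rewrite (_ : _ - _ = len k); last by rewrite -natr1; ring.
apply; first exact: cell_itv.
move=> t /(cell_window x01)[t01 ct]; split=> //; have /andP[t0 _] := t01.
have := base_le_height k x; have := height_le_base k x.
have := base_le_height k t; have := height_le_base k t.
rewrite (cell_eq_base t0 x0 ct) => h1 h2 h3 h4.
by rewrite ler_norml; apply/andP; split; lra.
Qed.

(** Removing its first child leaves an interval in the cell of [x], on which the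
    heights differ only by later liftings. *)
Lemma mu_ball_ge_grounded x r k : 0 <= x < 1 -> 0 < r -> 4 * hgt k.+1 <= r ->
  ~~ lifted k x -> ((Num.min (r / 2) (len k / 4) / 2)%:E <= mu (ball x r))%E.
Proof.
move=> x01 r0 hr nlx; have /andP[x0 _] := x01.
pose lo : R := (cell k x)%:R * len k + len k.+1.
pose hi : R := (cell k x).+1%:R * len k.
have l1 := lenS_le (R := R) k; have l0 := len_gt0 (R := R) k.
have l10 := len_gt0 (R := R) k.+1.
have hilo : hi - lo = len k - len k.+1 by rewrite /hi /lo -natr1; ring.
apply: (@le_trans _ _ (Num.min (r / 2) ((hi - lo) / 2) / 2)%:E).
  rewrite lee_fin ler_pM2r// hilo; apply: le_min2; lra.
have xlo : lo <= x by rewrite leNgt -lifted_itv.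
have /andP[_ xhi] := cell_itv k x0.
apply: mu_ball_ge => //; first by rewrite xlo.
move=> t /andP[tlo thi].
have [|t01 ct] := @cell_window k x t x01.
  by apply/andP; split=> //; move: tlo; rewrite /lo; lra.
split=> //; have /andP[t0 _] := t01.
have nlt : ~~ lifted k t by rewrite lifted_itv ct -leNgt.
have := base_le_height k.+1 x; have := height_le_base k.+1 x.
have := base_le_height k.+1 t; have := height_le_base k.+1 t.
rewrite !baseS (negbTE nlx) (negbTE nlt) (cell_eq_base t0 x0 ct) => h1 h2 h3 h4.
by rewrite ler_norml; apply/andP; split; lra.
Qed.

(** The part of the cell of [x] directly to the right of its first child lies lower
    by about [hgt k]; by the triangle inequality the ball contains a part of it of
    length about [hgt k * Num.sqrt (eps k) / 2], and [eps k] is small compared with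
    [Num.sqrt (eps k)]. *)
Lemma mu_ball_ge_lifted x r k : 0 <= x < 1 -> lifted k x ->
  hgt k * (1 + Num.sqrt (eps k)) <= r ->
  ((hgt k * Num.sqrt (eps k) / 8)%:E <= mu (ball x r))%E.
Proof.
move=> x01 lx; have /andP[x0 _] := x01; set s := Num.sqrt _ => hr.
have l1 := lenS (R := R) k; have l0 := len_gt0 (R := R) k.
have s0 : 0 < s := sqrt_eps_gt0 k.
have es : eps k <= s / 64 := eps_le_sqrt k.
have s1 : s <= 64^-1 := sqrt_eps_le k.
have lE : len k = 16 * hgt k :> R by rewrite /hgt; field.
have h0 := hgt_gt0 (R := R) k; have h1 := hgtS (R := R) k.
have e0 := eps_gt0 (R := R) k.
have eh : hgt k * eps k <= hgt k * (s / 64) by rewrite ler_pM2l.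
have hs : hgt k * s <= hgt k * 64^-1 by rewrite ler_pM2l.
pose q : R := (cell k x)%:R * len k.
have /andP[qx _] := cell_itv k x0; rewrite -/q in qx.
have xq : x < q + len k.+1 by rewrite -lifted_itv.
apply: (@le_trans _ _ (((q + hgt k * s / 2) - (q + len k.+1)) / 2)%:E).
  by rewrite lee_fin l1 lE; lra.
apply: mu_ge_projection => t /andP[t1 t2].
have qE : (cell k x).+1%:R * len k = q + len k by rewrite -natr1 mulrDl mul1r.
have [|t01 ct] := @cell_window k x t x01.
  by rewrite qE -/q; apply/andP; split; have := len_gt0 (R := R) k.+1; lra.
split=> //; have /andP[t0 _] := t01.
have nlt : ~~ lifted k t by rewrite lifted_itv ct -leNgt.
have xt : `|x - t| <= hgt k * s / 2 by rewrite ler_norml; apply/andP; split; lra.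
have xht : `|height x - height t| <= hgt k + 2 * hgt k.+1.
  have := base_le_height k.+1 x; have := height_le_base k.+1 x.
  have := base_le_height k.+1 t; have := height_le_base k.+1 t.
  rewrite !baseS lx (negbTE nlt) (cell_eq_base t0 x0 ct) mulr1n mulr0n => k1 k2 k3 k4.
  by rewrite ler_norml; apply/andP; split; lra.
rewrite /eucl_ball/=; apply: le_trans hr.
apply: le_trans (@eucl_dist_le _ (x, height x) (t, height t) _ _ xt xht) _.
by rewrite h1; lra.
Qed.

End beta_graph.

(** * The three regimes of scales *)

HB.lock Definition beta_const (R : realType) : R := 512 * 32.

Lemma beta_const_ge1 (R : realType) : 1 <= beta_const R.
Proof. by rewrite beta_const.unlock; lra. Qed.

Section beta_scales.
Context {R : realType}.
Variables (x p : R).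
Hypotheses (x01 : 0 <= x < 1) (p12 : 1 <= p < 2).
Implicit Types (r : R) (k : nat).
Notation mu := (hausdorff1_restr (@jump_graph R)).
Notation ball r := (eucl_ball (x, height x) r).
Notation beta2 r := (beta_tilde mu p (x, height x) r ^+ 2)%E.
Notation C := (beta_const R).

Let x0 : 0 <= x. Proof. by have /andP[] := x01. Qed.
Let p0 : 0 < p. Proof. by have /andP[p1 _] := p12; exact: lt_le_trans p1. Qed.

Let expo12 : 1 <= 2 / p <= 2.
Proof.
have /andP[p1 p2] := p12.
by rewrite ler_pdivlMr// mul1r (ltW p2)/= ler_pdivrMr// ler_pMr.
Qed.

Lemma beta2_le1 r : 0 < r -> (beta2 r <= 1)%E.
Proof.
move=> r0; apply: beta_tilde_sqr_le1 => //; rewrite mu_ball_lty andbT.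
have [k /(_ k (leqnn k)) kr] := len_lt r0; have l0 := len_gt0 (R := R) k.
have hr : 4 * hgt k <= r by rewrite /hgt; lra.
apply: lt_le_trans (mu_ball_ge_cell x01 r0 hr).
by rewrite lte_fin divr_gt0// lt_min !divr_gt0.
Qed.

Let powR_bound (e q : R) : 0 <= e -> 0 <= q <= 1 ->
  (C * e * q) `^ (2 / p) <= C ^+ 2 * e `^ (2 / p) * q.
Proof.
move=> e0 /andP[q0 q1]; have /andP[s1 s2] := expo12.
have C0 : 0 <= C := le_trans ler01 (beta_const_ge1 R).
rewrite !powRM ?mulr_ge0//.
apply: ler_pM; rewrite ?mulr_ge0 ?powR_ge0//.
  by rewrite ler_wpM2r ?powR_ge0// -powR_mulrn// ler_powR// beta_const_ge1.
move: q0; rewrite le_eqVlt => /predU1P[<-|q0].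
  by rewrite powR0// gt_eqF// (lt_le_trans ltr01).
by apply: ge1r_powR => //; rewrite q0.
Qed.

(** The common part of the three estimates below, which enclose the ball in a
    vertical strip and bound its mass from below. *)
Let beta2_ratio k a w v M r : 0 < r -> hgt k <= 2 * r -> len k <= w -> 0 < v ->
  (forall y, jump_graph y -> ball r y -> a <= y.1 <= a + w /\ base k y.1 = base k x) ->
  (v%:E <= mu (ball r))%E -> 4 * eps k * len k * w / r <= M * v ->
  (beta2 r <= (M `^ (2 / p))%:E)%E.
Proof.
move=> r0 hr kw v0 Bab vmu uM.
have w0 : 0 <= w by rewrite (le_trans (ltW (len_gt0 _)) kw).
have u0 : 0 <= 4 * eps k * len k * w / r.
  rewrite divr_ge0 ?(ltW r0)// mulr_ge0// mulr_ge0 ?(ltW (len_gt0 _))//.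
  by rewrite mulr_ge0 ?(ltW (eps_gt0 _)).
apply: le_trans (beta_tilde_sqr_le p0 u0 v0 (beta_numerator_le p12 r0 hr kw Bab) vmu) _.
have uv : 4 * eps k * len k * w / r / v <= M by rewrite ler_pdivrMr.
have uv0 : 0 <= 4 * eps k * len k * w / r / v by rewrite divr_ge0// ltW.
rewrite lee_fin; apply: ge0_ler_powR => //; rewrite ?nnegrE//.
  by rewrite divr_ge0// ltW.
exact: le_trans uv.
Qed.

Lemma ball_separation k r y : r < sep k -> jump_graph y -> ball r y ->
  [/\ `|x - y.1| <= r, `|height x - height y.1| < sep k &
      base k.+1 y.1 = base k.+1 x].
Proof.
move=> rk [_ yh] By; split; first exact: le_trans (ler_dist1 (x, height x) y) By.
  by rewrite -yh; exact: le_lt_trans (le_trans (ler_dist2 (x, height x) y) By) rk.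
symmetry; apply: (height_sep_base (k := k)) => //.
by rewrite -yh; exact: le_lt_trans (le_trans (ler_dist2 (x, height x) y) By) rk.
Qed.

(** If [x] is lifted at stage [k], the ball sees only the cell of [x] of generation
    [k.+1], whose mass is comparable with [len k.+1]; otherwise its mass is
    comparable with [r]. In both cases a vertical strip whose width is
    comparable with this mass contains the part of the graph in the ball. *)
Lemma beta2_far k r : 8 * hgt k.+1 <= r < sep k ->
  (beta2 r <= (C ^+ 2 * eps k.+1 `^ (2 / p) * (len k.+1 / (32 * r)))%:E)%E.
Proof.
move=> /andP[hr rk]; have h0 := hgt_gt0 (R := R) k.+1.
have l0 := len_gt0 (R := R) k.+1; have e0 := eps_gt0 (R := R) k.+1.
have r0 : 0 < r by lra.
have lE : len k.+1 = 16 * hgt k.+1 :> R by rewrite /hgt; field.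
have lEk : len k = 16 * hgt k :> R by rewrite /hgt; field.
have rhk : r < hgt k := lt_le_trans rk (sep_le k).
have h2r : hgt k.+1 <= 2 * r by lra.
apply: (@le_trans _ _ ((C * eps k.+1 * (len k.+1 / (32 * r))) `^ (2 / p))%:E); last first.
  rewrite lee_fin powR_bound ?(ltW e0)// divr_ge0 ?(ltW l0) ?mulr_ge0 ?(ltW r0)//=.
  by rewrite ler_pdivrMr ?mulr_gt0// mul1r; lra.
have X (w v : R) : 0 <= v -> w <= 8 * v -> 4 * eps k.+1 * len k.+1 * w / r <=
    C * eps k.+1 * (len k.+1 / (32 * r)) * v.
  move=> v0 wv; have -> : C * eps k.+1 * (len k.+1 / (32 * r)) * v =
    (eps k.+1 * len k.+1) / r * (512 * v).
    by rewrite beta_const.unlock; field; rewrite gt_eqF.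
  have -> : 4 * eps k.+1 * len k.+1 * w / r = (eps k.+1 * len k.+1) / r * (4 * w).
    by field; rewrite gt_eqF.
  have a0 : 0 <= eps k.+1 * len k.+1 / r.
    by rewrite divr_ge0 ?mulr_ge0 ?(ltW e0) ?(ltW l0) ?(ltW r0).
  by apply: ler_wpM2l => //; lra.
have [lx|nlx] := boolP (lifted k x).
  apply: (@beta2_ratio k.+1 ((cell k.+1 x)%:R * len k.+1) (len k.+1)
    (len k.+1 / 8)) => //.
  - by rewrite divr_gt0.
  - move=> y Ey By; have [xy hxy yb] := ball_separation rk Ey By; split=> //.
    have [/andP[y0 _] _] := Ey.
    have c := lifted_isolated x0 y0 lx (le_lt_trans xy rhk) hxy.
    have := cell_itv k.+1 y0; rewrite -c -natr1 mulrDl mul1r => /andP[-> /ltW ->//].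
  - have r4 : 4 * hgt k.+1 <= r by lra.
    apply: le_trans (mu_ball_ge_cell x01 r0 r4).
    by rewrite lee_fin ler_pdivlMr// le_min; apply/andP; split; lra.
  - by apply: X; lra.
apply: (@beta2_ratio k.+1 (x - r) (2 * r) (r / 4)) => //.
- by lra.
- by rewrite divr_gt0.
- move=> y Ey By; have [xy _ yb] := ball_separation rk Ey By; split=> //.
  by move: xy; rewrite ler_norml => /andP[? ?]; apply/andP; split; lra.
- have r4 : 4 * hgt k.+1 <= r by lra.
  apply: le_trans (mu_ball_ge_grounded x01 r0 r4 nlx).
  by rewrite lee_fin ler_pdivlMr// le_min; apply/andP; split; lra.
- by apply: X; lra.
Qed.

Let near_window k r : sep k.+1 <= r -> r < 8 * hgt k.+1 -> r < sep k ->
  forall y, jump_graph y -> ball r y ->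
    x - r <= y.1 <= x - r + len k.+1 /\ base k.+1 y.1 = base k.+1 x.
Proof.
move=> rK hr rk y Ey By; have [xy _ yb] := ball_separation rk Ey By; split=> //.
have lE : len k.+1 = 16 * hgt k.+1 :> R by rewrite /hgt; field.
by move: xy; rewrite ler_norml => /andP[? ?]; apply/andP; split; lra.
Qed.

Lemma beta2_near_grounded k r : sep k.+1 <= r -> r < 8 * hgt k.+1 -> r < sep k ->
  ~~ lifted k.+1 x ->
  (beta2 r <= (C ^+ 2 * eps k.+1 `^ (2 / p) * (len k.+1 / (32 * r)))%:E)%E.
Proof.
move=> rK hr rk nlx; have h0 := hgt_gt0 (R := R) k.+1.
have l0 := len_gt0 (R := R) k.+1; have e0 := eps_gt0 (R := R) k.+1.
have lE : len k.+1 = 16 * hgt k.+1 :> R by rewrite /hgt; field.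
have lr : len k.+1 <= 32 * r.
  by have := le_trans (sep_ge k.+1) rK; lra.
have r0 : 0 < r by lra.
have q01 : 0 <= len k.+1 / (32 * r) <= 1.
  rewrite divr_ge0 ?(ltW l0) ?mulr_ge0 ?(ltW r0)//=.
  by rewrite ler_pdivrMr ?mulr_gt0// mul1r.
apply: (@le_trans _ _ ((C * eps k.+1 * (len k.+1 / (32 * r))) `^ (2 / p))%:E); last first.
  by rewrite lee_fin powR_bound ?(ltW e0).
apply: (@beta2_ratio k.+1 (x - r) (len k.+1) (r / 4)) => //.
- by lra.
- by rewrite divr_gt0.
- exact: near_window.
- have r4 : 4 * hgt k.+2 <= r.
    rewrite hgtS; have := eps_le (R := R) k.+1 => e1.
    have : eps k.+1 * hgt k.+1 <= 64^-1 * hgt k.+1 :> R by rewrite ler_wpM2r// ltW.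
    lra.
  apply: le_trans (mu_ball_ge_grounded x01 r0 r4 nlx).
  by rewrite lee_fin ler_pdivlMr// le_min; apply/andP; split; lra.
- have -> : C * eps k.+1 * (len k.+1 / (32 * r)) * (r / 4) =
    4 * eps k.+1 * len k.+1 / r * (32 * r).
    by rewrite beta_const.unlock; field; rewrite gt_eqF.
  have -> : 4 * eps k.+1 * len k.+1 * len k.+1 / r =
    4 * eps k.+1 * len k.+1 / r * len k.+1 by field; rewrite gt_eqF.
  rewrite ler_wpM2l// divr_ge0 ?(ltW r0)// mulr_ge0 ?(ltW l0)//.
  by rewrite mulr_ge0 ?(ltW e0).
Qed.

(** The mass of the ball is at least [hgt k.+1 * s / 8], where [s] is the square root
    of [eps k.+1], and the numerator is at most a multiple of [s * s * hgt k.+1]. *)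
Lemma beta2_near_lifted k r : hgt k.+1 * (1 + Num.sqrt (eps k.+1)) <= r ->
  r < 8 * hgt k.+1 -> r < sep k -> lifted k.+1 x ->
  (beta2 r <= (C ^+ 2 * Num.sqrt (eps k.+1))%:E)%E.
Proof.
move=> rH hr rk lx; have h0 := hgt_gt0 (R := R) k.+1.
have l0 := len_gt0 (R := R) k.+1; have e0 := eps_gt0 (R := R) k.+1.
have lE : len k.+1 = 16 * hgt k.+1 :> R by rewrite /hgt; field.
have s0 := sqrt_eps_gt0 (R := R) k.+1; have s1 := sqrt_eps_le (R := R) k.+1.
have ss := sqr_sqrt_eps (R := R) k.+1.
have muge := mu_ball_ge_lifted x01 lx rH.
set s := Num.sqrt _ in rH s0 s1 ss muge *.
have hs0 : 0 < hgt k.+1 * s by rewrite mulr_gt0.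
have hr1 : hgt k.+1 <= r by move: rH; rewrite mulrDr mulr1; lra.
have r0 : 0 < r by lra.
have rK : sep k.+1 <= r := le_trans (sep_le k.+1) hr1.
apply: (@le_trans _ _ ((C * s * 1) `^ (2 / p))%:E); last first.
  rewrite lee_fin (le_trans (powR_bound (ltW s0) _)) ?ler01 ?lexx//.
  rewrite mulr1 ler_wpM2l// ?sqr_ge0//; have /andP[? _] := expo12.
  by apply: ge1r_powR => //; rewrite s0; lra.
apply: (@beta2_ratio k.+1 (x - r) (len k.+1) (hgt k.+1 * s / 8)) => //.
- by lra.
- by rewrite divr_gt0.
- exact: near_window.
- rewrite ler_pdivrMr// -ss lE.
  have -> : 4 * (s * s) * (16 * hgt k.+1) * (16 * hgt k.+1) =
    1024 * hgt k.+1 * (s * s * hgt k.+1) by ring.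
  have -> : C * s * 1 * (hgt k.+1 * s / 8) * r = (2048 * r) * (s * s * hgt k.+1).
    by rewrite beta_const.unlock; field.
  by rewrite ler_wpM2r ?mulr_ge0 ?(ltW s0) ?(ltW h0)//; lra.
Qed.

End beta_scales.

(** * Integration over the scales *)

Section inverse_square.
Context {R : realType}.
Implicit Types (a r : R).

Lemma integral_inv_sqr a : 0 < a ->
  (\int[lebesgue_measure]_(r in `[a, +oo[) (r ^- 2)%:E = (a^-1)%:E)%E.
Proof.
move=> a0.
rewrite (@ge0_continuous_FTC2y _ _ (fun r => - r^-1) a 0).
- by rewrite -EFinB sub0r opprK.
- by move=> r ar; rewrite invr_ge0 exprn_ge0// (le_trans (ltW a0)).
- apply/continuous_within_itvcyP; split.
    move=> r; rewrite in_itv/= andbT => ar; have r0 := lt_trans a0 ar.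
    apply: cvgV; first by rewrite expf_neq0// gt_eqF.
    exact: exprn_continuous.
  apply: cvg_at_right_filter; apply: cvgV; first by rewrite expf_neq0// gt_eqF.
  exact: exprn_continuous.
- rewrite -[X in _ --> X]oppr0; apply: cvgN; apply/gtr0_cvgV0; last exact: cvg_id.
  by near=> r; near: r; exact: nbhs_pinfty_gt.
- move=> r ar; have r0 := lt_trans a0 ar.
  by apply: derivableN; apply: derivableV => //; rewrite gt_eqF.
- apply: cvg_at_right_filter; apply: cvgN; apply: cvgV; first by rewrite gt_eqF.
  exact: cvg_id.
- move=> r; rewrite in_itv/= andbT => ar; have r0 := lt_trans a0 ar.
  rewrite derive1E deriveN; last by apply: derivableV => //; rewrite gt_eqF.
  rewrite deriveV//; last by rewrite gt_eqF.
  by rewrite derive_id scaleNr opprK /GRing.scale/= mulr1.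
Unshelve. all: by end_near. Qed.

Lemma measurable_inv_sqr (D : set R) : D `<=` `]0, +oo[ ->
  measurable_fun D (fun r => r ^- 2).
Proof.
move=> D0.
have m : measurable_fun (`]0%R, +oo[%classic : set R) (fun r => r ^- 2).
  apply: open_continuous_measurable_fun; first exact: interval_open.
  apply/in_setP => r /=; rewrite in_itv/= andbT => r0.
  apply: cvgV; first by rewrite expf_neq0// gt_eqF.
  exact: exprn_continuous.
by apply: measurable_funS D0 m.
Qed.

Lemma integral_indic_le (D : set R) a b : measurable D -> a <= b ->
  (\int[lebesgue_measure]_(r in D) (\1_`[a, b] r)%:E <= (b - a)%:E)%E.
Proof.
move=> mD ab; rewrite integral_indic//.
apply: (@le_trans _ _ (lebesgue_measure `[a, b])).
  by apply: le_measure; rewrite ?inE//; exact: measurableI.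
by rewrite lebesgue_measure_itv/= lte_fin; case: ifPn => _; rewrite ?lee_fin ?subr_ge0.
Qed.

End inverse_square.

Section square_function.
Context {R : realType}.
Variables (x p : R).
Hypotheses (x01 : 0 <= x < 1) (p12 : 1 <= p < 2).
Implicit Types (r : R) (k : nat).
Notation mu := (hausdorff1_restr (@jump_graph R)).
Notation beta2 r := (beta_tilde mu p (x, height x) r ^+ 2)%E.
Notation C := (beta_const R).

(** The weights of the majorant: [flat] for the regime in which a horizontal line is a
    good approximation, [bump] for the centres lifted at stage [k], with the trivial
    bound [1] for the coefficient on [crossing] and a multiple of
    [Num.sqrt (eps k)] on [near_scale]. *)
Let flat k : R := C ^+ 2 * eps k `^ (2 / p) * (len k / 32).

Let flat_ge0 k : 0 <= flat k.
Proof.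
rewrite /flat mulr_ge0 ?divr_ge0 ?(ltW (len_gt0 _))//.
by rewrite mulr_ge0 ?sqr_ge0 ?powR_ge0.
Qed.

Let inv_sqr_tail k r : R := r ^- 2 * \1_`[sep k, +oo[ r.
Let crossing k r : R := \1_`[sep k, hgt k * (1 + Num.sqrt (eps k))] r.
Let near_scale k r : R := \1_`[sep k, 8 * hgt k] r.

Let bump k : R := \1_(lifts k) x * (32 / len k).

Let bump_ge0 k : 0 <= bump k.
Proof. by rewrite mulr_ge0// divr_ge0// ltW// len_gt0. Qed.

Let major k r : \bar R :=
  ((flat k)%:E * (inv_sqr_tail k r)%:E + ((bump k)%:E * (crossing k r)%:E +
   (bump k * (C ^+ 2 * Num.sqrt (eps k)))%:E * (near_scale k r)%:E))%E.

Let inv_sqr_tail_ge0 k r : 0 <= inv_sqr_tail k r.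
Proof. by rewrite mulr_ge0// invr_ge0 sqr_ge0. Qed.

Let bump3_ge0 k : 0 <= bump k * (C ^+ 2 * Num.sqrt (eps k)).
Proof. by rewrite mulr_ge0// mulr_ge0 ?sqr_ge0 ?sqrtr_ge0. Qed.

Let major_ge0 k r : (0 <= major k r)%E.
Proof.
by rewrite !adde_ge0// mule_ge0// lee_fin.
Qed.

Let D : set R := `]0, 1[.

Let measurable_inv_sqr_tail k : measurable_fun D (EFin \o inv_sqr_tail k).
Proof.
apply/measurable_EFinP; apply: measurable_funM; last exact: measurable_indic.
by apply: measurable_inv_sqr => r; rewrite /D/= !in_itv/= => /andP[->].
Qed.

Let measurable_indicator (I : set R) : measurable I ->
  measurable_fun D (EFin \o (\1_I : R -> R)).
Proof. by move=> mI; apply/measurable_EFinP; exact: measurable_indic. Qed.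

Let measurable_major k : measurable_fun D (major k).
Proof.
apply: emeasurable_funD; last apply: emeasurable_funD.
- by apply: measurable_funeM; exact: measurable_inv_sqr_tail.
- by apply: measurable_funeM; exact: measurable_indicator.
- by apply: measurable_funeM; exact: measurable_indicator.
Qed.

Let integral_inv_sqr_tail k :
  (\int[lebesgue_measure]_(r in D) (inv_sqr_tail k r)%:E <= (32 / len k)%:E)%E.
Proof.
have l0 := len_gt0 (R := R) k.
apply: (@le_trans _ _ ((sep k)^-1)%:E); last first.
  by rewrite lee_fin -[32 / _]invf_div lef_pV2 ?posrE ?divr_gt0 ?sep_gt0 ?sep_ge.
rewrite -(integral_inv_sqr (sep_gt0 k)) [leLHS]integral_mkcond [leRHS]integral_mkcond.
apply: ge0_le_integral_nonmeasurable => r _.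
  by apply: erestrict_ge0 => ? _; rewrite lee_fin.
rewrite !patchE; case: ifPn => [rD|_]; last first.
  by case: ifPn => // _; rewrite lee_fin invr_ge0 sqr_ge0.
by rewrite /inv_sqr_tail indicE; case: (_ \in _) => /=; rewrite ?mulr1 ?mulr0.
Qed.

Let integral_major k :
  (\int[lebesgue_measure]_(r in D) major k r <=
    (C ^+ 2 * eps k `^ (2 / p) +
     (4 + 16 * C ^+ 2) * (Num.sqrt (eps k) * \1_(lifts k) x))%:E)%E.
Proof.
have l0 := len_gt0 (R := R) k; have h0 := hgt_gt0 (R := R) k.
have s0 := sqrt_eps_gt0 (R := R) k; have es := eps_le_sqrt (R := R) k.
have mD : measurable D by exact: measurable_itv.
have m2 := measurable_indicator
  (@measurable_itv R `[sep k, hgt k * (1 + Num.sqrt (eps k))]).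
have m3 := measurable_indicator (@measurable_itv R `[sep k, 8 * hgt k]).
have m1 := measurable_inv_sqr_tail k.
have lE : len k = 16 * hgt k :> R by rewrite /hgt; field.
rewrite ge0_integralD//; last 4 first.
- by move=> r _; rewrite mule_ge0 ?lee_fin.
- exact: measurable_funeM.
- by move=> r _; rewrite adde_ge0// mule_ge0 ?lee_fin.
- by apply: emeasurable_funD; exact: measurable_funeM.
rewrite ge0_integralD//; last 4 first.
- by move=> r _; rewrite mule_ge0 ?lee_fin.
- exact: measurable_funeM.
- by move=> r _; rewrite mule_ge0 ?lee_fin.
- exact: measurable_funeM.
rewrite !ge0_integralZl ?lee_fin//; try by move=> r _; rewrite lee_fin.
have sh := sep_le (R := R) k.
have I2 : (\int[lebesgue_measure]_(r in D) (crossing k r)%:E <=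
    (hgt k * (2 * Num.sqrt (eps k)))%:E)%E.
  apply: le_trans (integral_indic_le mD _) _.
    by rewrite (le_trans sh)// ler_pMr// lerDl ltW.
  rewrite lee_fin /sep -mulrBr ler_wpM2l ?(ltW h0)//; lra.
have I3 : (\int[lebesgue_measure]_(r in D) (near_scale k r)%:E <= (8 * hgt k)%:E)%E.
  apply: le_trans (integral_indic_le mD _) _; first by lra.
  by rewrite lee_fin; have := sep_gt0 (R := R) k; lra.
apply: (@le_trans _ _ ((flat k)%:E * (32 / len k)%:E +
  ((bump k)%:E * (hgt k * (2 * Num.sqrt (eps k)))%:E +
   (bump k * (C ^+ 2 * Num.sqrt (eps k)))%:E * (8 * hgt k)%:E))%E).
  apply: leeD; first by apply: lee_wpmul2l; rewrite ?lee_fin.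
  by apply: leeD; apply: lee_wpmul2l; rewrite ?lee_fin.
rewrite -!EFinM -!EFinD lee_fin le_eqVlt; apply/orP; left; apply/eqP.
rewrite /flat /bump lE; field.
by rewrite gt_eqF.
Qed.

Let beta2_le_major k r : sep k.+1 <= r < sep k ->
  (beta2 r * (r^-1)%:E <= major k.+1 r)%E.
Proof.
move=> /andP[rK rk]; have r0 : 0 < r := lt_le_trans (sep_gt0 _) rK.
have l0 := len_gt0 (R := R) k.+1.
have ri : 0 <= r^-1 by rewrite invr_ge0 ltW.
have rl : r^-1 <= 32 / len k.+1.
  rewrite -[32 / _]invf_div lef_pV2 ?posrE ?divr_gt0//.
  exact: le_trans (sep_ge _) rK.
have flatP : (beta2 r <= (C ^+ 2 * eps k.+1 `^ (2 / p) * (len k.+1 / (32 * r)))%:E)%E ->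
    (beta2 r * (r^-1)%:E <= major k.+1 r)%E.
  move=> h; apply: (@le_trans _ _ ((flat k.+1)%:E * (inv_sqr_tail k.+1 r)%:E)%E).
    apply: le_trans (lee_wpmul2r _ h) _; first by rewrite lee_fin.
    rewrite -!EFinM lee_fin /flat /inv_sqr_tail indicE mem_set ?mulr1; last first.
      by rewrite /= in_itv/= rK.
    rewrite le_eqVlt; apply/orP; left; apply/eqP; field.
    by rewrite gt_eqF.
  by rewrite leeDl// adde_ge0// mule_ge0// lee_fin.
have [hr|hr] := leP (8 * hgt k.+1) r.
  by apply: flatP; apply: beta2_far => //; rewrite hr.
have [lx|nlx] := boolP (lifted k.+1 x); last first.
  by apply: flatP; exact: beta2_near_grounded.
have bE : bump k.+1 = 32 / len k.+1 by rewrite /bump indicE mem_set// mul1r.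
have [rH|rH] := leP r (hgt k.+1 * (1 + Num.sqrt (eps k.+1))).
  apply: (@le_trans _ _ ((bump k.+1)%:E * (crossing k.+1 r)%:E)%E); last first.
    rewrite /major addeCA leeDl// adde_ge0// mule_ge0 ?lee_fin//.
  apply: le_trans (lee_wpmul2r _ (beta2_le1 x01 p12 r0)) _; first by rewrite lee_fin.
  rewrite mul1e -EFinM lee_fin bE /crossing indicE mem_set ?mulr1//.
  by rewrite /= in_itv/= rK.
apply: (@le_trans _ _ ((bump k.+1 * (C ^+ 2 * Num.sqrt (eps k.+1)))%:E *
    (near_scale k.+1 r)%:E)%E); last first.
  rewrite /major addeA leeDr// adde_ge0// mule_ge0 ?lee_fin//.
apply: le_trans (lee_wpmul2r _ (beta2_near_lifted x01 p12 (ltW rH) hr rk lx)) _.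
  by rewrite lee_fin.
rewrite -!EFinM lee_fin bE /near_scale indicE mem_set ?mulr1; last first.
  by rewrite /= in_itv/= rK ltW.
by rewrite mulrC ler_wpM2r// mulr_ge0 ?sqr_ge0 ?sqrtr_ge0.
Qed.

Lemma square_function_lty : (lift_sum x < +oo)%E ->
  (\int[lebesgue_measure]_(r in `]0%R, 1%R[) (beta2 r * (r^-1)%:E) < +oo)%E.
Proof.
move=> xfin.
have /andP[p1 p2] := p12; have p0 : 0 < p := lt_le_trans ltr01 p1.
have dom r : D r -> (beta2 r * (r^-1)%:E <= 32%:E + \sum_(k <oo) major k r)%E.
  rewrite /D/= in_itv/= => /andP[r0 r1].
  have ri : 0 <= r^-1 by rewrite invr_ge0 ltW.
  have [r_big|r_small] := leP (sep 0) r.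
    apply: (@le_trans _ _ 32%:E); last by rewrite leeDl// nneseries_ge0.
    apply: le_trans (lee_wpmul2r _ (beta2_le1 x01 p12 r0)) _; first by rewrite lee_fin.
    rewrite mul1e lee_fin -[leRHS]invrK lef_pV2 ?posrE ?invr_gt0//.
    by apply: le_trans r_big; have := sep_ge (R := R) 0; rewrite len0 mul1r.
  have exk : exists k, sep k <= r.
    have [k /(_ k (leqnn k)) kr] := len_lt r0; exists k.
    have := len_gt0 (R := R) k.
    by have := sep_le (R := R) k; rewrite /hgt; lra.
  case: (ex_minnP exk) => -[|k] kr mink; first by move: r_small; rewrite ltNge kr.
  have rk : r < sep k.
    by rewrite ltNge; apply/negP => /mink; rewrite ltnn.
  apply: (@le_trans _ _ (major k.+1 r)); first by apply: beta2_le_major; rewrite kr.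
  apply: (@le_trans _ _ (\sum_(k <oo) major k r)%E).
    apply: le_trans (nneseries_lim_ge k.+2 (fun n _ _ => major_ge0 n r)).
    by rewrite big_nat_recr//= leeDr// sume_ge0.
  by rewrite leeDr// lee_fin.
apply: (@le_lt_trans _ _ (\int[lebesgue_measure]_(r in D)
    (32%:E + \sum_(k <oo) major k r))%E).
  apply: ge0_le_integral_nonmeasurable => r Dr; last exact: dom.
  have := Dr; rewrite /D/= in_itv/= => /andP[r0 _].
  apply: mule_ge0; first by apply: mule_ge0; exact: beta_tilde_ge0.
  by rewrite lee_fin invr_ge0 ltW.
have mD : measurable D by exact: measurable_itv.
have LD : lebesgue_measure (`]0%R, 1%R[%classic : set R) = 1%E.
  by rewrite lebesgue_measure_itv/= lte01 sube0.
have m_sum : measurable_fun D (fun r => \sum_(k <oo) major k r)%E.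
  by apply: ge0_emeasurable_sum => // k _; exact: measurable_major.
rewrite ge0_integralD//; try by move=> r _; exact: nneseries_ge0.
rewrite integral_cst// integral_nneseries//.
rewrite lte_add_pinfty//.
  rewrite [X in (_ * X)%E](_ : _ = 1%E); first by rewrite mule1 ltry.
  exact: LD.
pose c : R := 4 + 16 * C ^+ 2.
have c0 : 0 <= c by rewrite addr_ge0// mulr_ge0// sqr_ge0.
apply: (@le_lt_trans _ _ (\sum_(k <oo) ((C ^+ 2)%:E * (eps k `^ (2 / p))%:E +
   c%:E * (Num.sqrt (eps k) * \1_(lifts k) x)%:E))%E).
  apply: lee_nneseries => [k _ _|k _]; first exact: integral_ge0.
  by apply: le_trans (integral_major k) _; rewrite -!EFinM -EFinD.
have s0 k : 0 <= Num.sqrt (eps k) * \1_(lifts k) x by rewrite mulr_ge0 ?sqrtr_ge0.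
rewrite nneseriesD; last 2 first.
- by move=> k _ _; rewrite mule_ge0 ?lee_fin ?sqr_ge0 ?powR_ge0.
- by move=> k _ _; rewrite mule_ge0 ?lee_fin.
rewrite !nneseriesZl; last 2 first.
- by move=> k _; rewrite lee_fin.
- by move=> k _; rewrite lee_fin powR_ge0.
rewrite lte_add_pinfty// lte_mul_pinfty ?lee_fin ?sqr_ge0//.
by apply: eps_powR_summable; rewrite ltr_pdivlMr// mul1r.
Qed.

End square_function.

Local Open Scope ereal_scope.

Theorem theorem3p1 (R : realType) :
  exists E : set (R * R),
    [/\ 0 < hausdorff1 E < +oo,
        purely_unrectifiable E &
        forall p : R, (1 <= p < 2)%R ->
          {ae @hausdorff1 R, forall x, E x ->
            \int[lebesgue_measure]_(r in `]0%R, 1%R[)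
              (beta_tilde (hausdorff1_restr E) p x r ^+ 2 * (r^-1)%:E) < +oo}].
Proof.
exists jump_graph; split.
- by rewrite hausdorff1_jump_graph_gt0 hausdorff1_jump_graph_lty.
- exact: jump_graph_purely_unrectifiable.
- move=> p p12; have [N [mN N0 Nfin]] := @lift_sum_ae R.
  exists N; split=> // -[x1 x2] /= nP; apply: contrapT => nN; apply: nP => Ex.
  have [x01 /= xh] := Ex; rewrite xh.
  by apply: square_function_lty => //; have := Nfin _ Ex nN.
Qed.
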